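(* Let $p$ be a prime for which there exist a prime power $q$ and integers $d\ge 3$, $k\ge 1$ with $p^k=(q^d-1)/(q-1)$. Then for every positive integer $N$: (i) there is a finite group $G$ such that all $p$-complements in $G$ are conjugate in ${\rm Aut}\,G$, but they form at least $N$ conjugacy classes in $G$; (ii) there is a finite group $G$ such that all $p$-complements in $G$ are isomorphic, but they form at least $N$ orbits under ${\rm Aut}\,G$; (iii) there is a finite group $G$ whose $p$-complements form at least $N$ isomorphism classes.
   Context: A $p$-complement in a finite group $G$ (with $p$ a prime dividing $|G|$) is a subgroup of $G$ of index a power of $p$ and of order coprime to $p$. *)

(* Defs.v *)
From mathcomp Require Import all_boot all_fingroup all_solvable.

Set Implicit Arguments.
Unset Strict Implicit.
Unset Printing Implicit Defensive.

Local Open Scope group_scope.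

Definition prime_power (q : nat) : Prop :=
  exists r e : nat, [/\ prime r, (0 < e)%N & q = (r ^ e)%N].

Section PComplements.

Variables (gT : finGroupType) (p : nat) (G : {group gT}).
Implicit Types H K : {group gT}.

(* For p prime, p.-nat n says that n is a power of p, possibly p ^ 0. *)
Definition p_complement H : bool :=
  [&& prime p, p %| #|G|, H \subset G, p.-nat #|G : H| & coprime #|H| p].

Definition p_complements : {set {group gT}} := [set H | p_complement H].

(* 'P^* lets permutations act on subsets: 'P^* H a is the image of H by a. *)
Definition Aut_orbit H : {set {set gT}} := orbit 'P^* (Aut G) H.

Definition p_complement_classes : {set {set {set gT}}} :=
  [set (H : {set gT}) :^: G | H : {group gT} in p_complements].

Definition p_complement_Aut_orbits : {set {set {set gT}}} :=
  [set Aut_orbit H | H : {group gT} in p_complements].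

Definition p_complement_isog_classes : {set {set {group gT}}} :=
  equivalence_partition (fun H K => H \isog K) p_complements.

End PComplements.

(* Main.v *)
Require Import Defs.
From HB Require Import structures.
From mathcomp Require Import all_boot all_order all_algebra all_fingroup all_solvable all_field.
From mathcomp Require Import zify ring.

(* Let F be the field with q elements and L = GL_d(F).  Zsigmondy-type
   arithmetic shows that p divides no q^i - 1 with 0 < i < d, so the stabilisers
   of lines and of hyperplanes are p-complements of L.  Conversely a
   p-complement H of L contains conjugates of all subgroups of r-power order,
   r = char F, hence all transvections with some centre v and all those with some
   axis w.  If v were off the hyperplane w, then H would be transitive on lines,
   and p would divide |H|; so the centres of H span a proper invariant subspace
   S.  Since L moves an i-dimensional subspace to at least q^(i(d-i)) others, S has
   dimension 1 or d-1, and H is the stabiliser of a line or of a hyperplane.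
   These two classes of L are distinct and are exchanged by the inverse
   transpose.

   The p-complements of a power L^C are the products of p-complements of L.
   (i) In L^C they form one orbit under automorphisms, but choosing the
   class of each coordinate freely gives many conjugacy classes.
   (ii) In the wreath product of L by a p-group C of order p^N the p-complements
   are those of the base L^C, all isomorphic.  The one with line stabilisers
   exactly at the coordinates in a subgroup D of C has a normaliser of order
   proportional to |D|, so these are in distinct orbits under automorphisms.
   (iii) In a power of AGL_d(F) the number of elements whose class size is prime to r
   is multiplicative over the coordinates; for a p-complement of AGL_d(F) it
   is at most q over a line stabiliser and more than q over a hyperplane
   stabiliser. *)

Set Implicit Arguments.
Unset Strict Implicit.
Unset Printing Implicit Defensive.

Import GRing.Theory.

(** * Repunits which are prime powers *)

Definition geom_sum (q n : nat) : nat := \sum_(i < n) q ^ i.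

Lemma geom_sumE q n : (q - 1) * geom_sum q n = q ^ n - 1.
Proof.
by rewrite !subn1 predn_exp. Qed.

(** Cut the sum into [b] blocks of length [a]; the block of index [j] is [(q ^ a) ^ j] times the
    first. *)
Lemma geom_sumM q a b : geom_sum q (a * b) = geom_sum q a * geom_sum (q ^ a) b.
Proof.
elim: b => [|b IH]; first by rewrite muln0 /geom_sum !big_ord0 muln0.
rewrite mulnS addnC {1}/geom_sum big_split_ord /= -/(geom_sum q (a * b)) IH.
rewrite [in RHS]/geom_sum big_ord_recr /= -/(geom_sum _ b) mulnDr; congr (_ + _).
rewrite /geom_sum big_distrl /=; apply: eq_bigr => i _.
by rewrite expnD expnM mulnC.
Qed.

Lemma geom_sum_mod q n m : q = 1 %[mod m] -> geom_sum q n = n %[mod m].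
Proof.
move=> q1; elim: n => [|n IH]; first by rewrite /geom_sum big_ord0.
rewrite /geom_sum big_ord_recr /= -/(geom_sum q n) -modnDml IH modnDml.
by rewrite -modnDmr -modnXm q1 modnXm exp1n modnDmr addn1.
Qed.

Lemma ltn_geom_sum q n : 0 < q -> 1 < n -> q < geom_sum q n.
Proof.
case: n => [|[|n]] // q0 _; rewrite /geom_sum !big_ord_recl /= expn0 expn1.
by rewrite addnA add1n; lia.
Qed.

(* Writing Q = 1 + pt, the sum is p + t p^2 (p-1)/2 modulo p^2. *)
Lemma geom_sum_prime_mod Q p : prime p -> odd p -> Q = 1 %[mod p] ->
  0 < Q -> geom_sum Q p = p %[mod p ^ 2].
Proof.
move=> pp op Q1 Q0.
have [t Qt] : exists t, Q = 1 + p * t.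
  have: p %| Q - 1 by rewrite -eqn_mod_dvd // Q1.
  by case/dvdnP=> t Qt; exists t; lia.
have powE j : exists s, Q ^ j = 1 + j * (p * t) + p ^ 2 * s.
  elim: j => [|j [s IH]]; first by exists 0; rewrite expn0 mul0n muln0.
  exists (j * t ^ 2 + s * (1 + p * t)); by rewrite expnS IH Qt; ring.
have sumE n : exists s, geom_sum Q n = n + p * t * 'C(n, 2) + p ^ 2 * s.
  elim: n => [|n [s IH]]; first by exists 0; rewrite /geom_sum big_ord0 bin0n !muln0.
  have [u Hu] := powE n; exists (s + u).
  rewrite /geom_sum big_ord_recr /= -/(geom_sum Q n) IH Hu binS bin1; ring.
have [s ->] := sumE p.
have [c ->] : exists c, 'C(p, 2) = p * c.
  have := prime_dvd_bin (k := 2) pp; rewrite /= => /(_ _)/dvdnP[].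
    by rewrite ltn_neqAle prime_gt1 // andbT; apply: contraTneq op => <-.
  by move=> c ->; exists c; rewrite mulnC.
have -> : p + p * t * (p * c) + p ^ 2 * s = (t * c + s) * p ^ 2 + p.
  by ring.
by rewrite modnMDl.
Qed.

Lemma dvdn_pfactor_gt p n m : prime p -> m %| p ^ n -> p < m -> p ^ 2 %| m.
Proof.
move=> pp /(dvdn_pfactor _ _ pp)[j _ ->] ltp; apply: dvdn_exp2l.
case: j ltp => [|[|j]] //; first by rewrite expn0 ltnNge prime_gt0.
by rewrite expn1 ltnn.
Qed.

(** If p divided q, only the term q^0 = 1 would survive modulo p, whereas the sum is a positive
    power of p. *)
Lemma repunit_coprime p q d k : prime p -> 1 < d -> 0 < q ->
  geom_sum q d = p ^ k -> coprime p q.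
Proof.
case: d => // d pp d1 q0 qd; rewrite prime_coprime //; apply/negP => pq.
have k0 : 0 < k by case: k qd => // qd; have := ltn_geom_sum q0 d1; rewrite qd ltnNge q0.
have : p %| geom_sum q d.+1 by rewrite qd dvdn_exp.
rewrite /geom_sum big_ord_recl expn0 addnC dvdn_addr ?dvdn1; first by case: eqP pp => // ->.
by apply: dvdn_sum => i _; rewrite dvdn_exp.
Qed.

(* If the order e of q modulo p were smaller than d, then with Q = q^e the sum
   1 + Q + ... + Q^(p-1) would be a power of p exceeding p; but for odd p it is
   p modulo p^2.  For p = 2 the factor 1 + q^2, which is 2 modulo 4, is used. *)
Lemma repunit_prime_power_order p q d k : prime p -> 1 < q -> 2 < d ->
  geom_sum q d = p ^ k -> forall i, 0 < i < d -> ~~ (p %| q ^ i - 1).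
Proof.
move=> pp q1 d2 qd.
have q0 := ltnW q1.
have k0 : 0 < k.
  case: k qd => // qd; have := @ltn_geom_sum q d q0 (ltnW d2).
  by rewrite qd expn0; lia.
have pd : p %| q ^ d - 1.
  by rewrite -geom_sumE qd dvdn_mull // dvdn_exp.
have cop : coprime p q := repunit_coprime pp (ltnW d2) q0 qd.
pose P e := (0 < e) && (p %| q ^ e - 1).
have exP : exists e, P e by exists d; rewrite /P pd andbT; lia.
(* The minimal such [e] is the multiplicative order of q modulo p. *)
case: (ex_minnP exP) => e /andP[e0 pe] emin i /andP[i0 id].
have modE a : (p %| q ^ a - 1) = (q ^ a == 1 %[mod p]).
  by rewrite eqn_mod_dvd // expn_gt0 q0.
have e_dvd a : p %| q ^ a - 1 -> e %| a.
  move=> pa; rewrite /dvdn; apply/negPn/negP => ne0.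
  have ltr := ltn_pmod a e0.
  suff : P (a %% e) by move/emin; rewrite leqNgt ltr.
  rewrite /P lt0n ne0 modE.
  have qe1 : q ^ e = 1 %[mod p] by apply/eqP; rewrite -modE.
  move: pa; rewrite !modE {1}(divn_eq a e) expnD (mulnC (a %/ e)) expnM.
  by rewrite -modnMml -modnXm qe1 modnXm exp1n modnMml mul1n.
apply/negP => pi; have ei := e_dvd _ pi.
have {ei i0 id pi i} lte : e < d by apply: leq_ltn_trans id; apply: dvdn_leq.
case/dvdnP: (e_dvd _ pd) => m dE.
pose Q := q ^ e.
have Q1 : Q = 1 %[mod p] by apply/eqP; rewrite -modE.
have m1 : 1 < m by rewrite -(ltn_pmul2r e0) mul1n -dE.
have Q0 : 0 < Q by rewrite expn_gt0 q0.
have ltqQ : q <= Q by rewrite -{1}(expn1 q) leq_exp2l.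
have fk : geom_sum Q m %| p ^ k by rewrite -qd dE mulnC geom_sumM dvdn_mull.
have dvd_p x : x %| p ^ k -> 1 < x -> p %| x.
  case/(dvdn_pfactor _ _ pp) => -[|j] _ -> //.
  by rewrite dvdn_exp.
have ltpQ : p < Q.
  have Qgt1 : 1 < Q := leq_trans q1 ltqQ.
  have := @dvdn_leq p (Q - 1); rewrite subn_gt0 leq_subRL // add1n.
  exact.
(* The sum of the Q^i for i < m divides p^k and exceeds 1, so p divides it; as Q is 1 modulo p, the
   sum is congruent to m. *)
have pm : p %| m.
  have : p %| geom_sum Q m by apply: dvd_p => //; apply: leq_trans (ltn_geom_sum Q0 m1).
  by rewrite /dvdn (geom_sum_mod _ Q1).
case/dvdnP: pm => m' mE.
have gk : geom_sum Q p %| p ^ k.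
  by apply: dvdn_trans fk; rewrite mE mulnC geom_sumM dvdn_mulr.
have p1 := prime_gt1 pp.
have p2g : p ^ 2 %| geom_sum Q p.
  by apply: dvdn_pfactor_gt gk _ => //; apply: ltn_trans (ltn_geom_sum Q0 p1).
have [op | ep] := boolP (odd p).
  move: p2g; rewrite /dvdn geom_sum_prime_mod // modn_small; last by rewrite ltn_Pmulr ?prime_gt0.
  by rewrite -leqn0 leqNgt prime_gt0.
have {}ep : p = 2 by case/even_prime: pp => // op; rewrite op in ep.
subst p; clear dvd_p.
have oq : odd q by move: cop; rewrite coprime2n.
have e1 : e = 1.
  apply/eqP; rewrite eqn_leq e0 andbT emin // /P expn1 /= dvdn2 oddB //; by rewrite oq.
(* This is where d > 2 enters: for d = 2 and a Mersenne prime q, the sum 1 + q is a power of 2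
   although 2 divides q - 1. *)
have m'1 : 1 < m' by move: d2; rewrite dE e1 mE; clear; lia.
have sq : q ^ 2 = 1 %[mod 4].
  have : q %% 4 = 1 \/ q %% 4 = 3.
    by have := oq; rewrite [q in odd q](divn_eq q 4) oddD oddM andbF /=;
       have := ltn_pmod q (isT : 0 < 4); case: (q %% 4) => [|[|[|[|]]]] //; auto.
  by rewrite -modnXm; case=> ->.
have dE2 : d = 2 * m' by rewrite dE e1 mE muln1 mulnC.
have gk2 : geom_sum (q ^ 2) m' %| 2 ^ k by rewrite -qd dE2 geom_sumM dvdn_mull.
have q20 : 0 < q ^ 2 by rewrite expn_gt0 q0.
(* The same argument with q^2 in place of Q: a power of 2 exceeding 1 is even, and this one is
   congruent to m' modulo 2. A second factor 2 in d makes 1 + q^2 a divisor of 2^k. *)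
have m'2 : 2 %| m'.
  case/(dvdn_pfactor _ _ pp): gk2 => -[|j] _ gE.
    by have := ltn_geom_sum q20 m'1; rewrite gE ltnNge q20.
  have := geom_sum_mod m' (m := 2) (q := q ^ 2).
  rewrite gE /dvdn => <-; first by rewrite expnS modnMr.
  by rewrite -(@modn_dvdm 4 _ 2) // sq.
case/dvdnP: m'2 => m'' m''E.
have : geom_sum (q ^ 2) 2 %| 2 ^ k.
  by apply: dvdn_trans gk2; rewrite m''E mulnC geom_sumM dvdn_mulr.
move/(dvdn_pfactor_gt pp) => /(_ _).
have lt2 : 2 < geom_sum (q ^ 2) 2.
  apply: leq_ltn_trans (ltn_geom_sum q20 _) => //.
  by rewrite (leq_trans q1) // -{1}(expn1 q) leq_exp2l.
by move/(_ lt2); rewrite /dvdn (geom_sum_mod _ sq).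
Qed.

(** * Wreath products and their bases *)

Local Open Scope group_scope.

Section AutOrbits.

Variables (gT : finGroupType) (G : {group gT}).
Implicit Types H K : {group gT}.

Lemma Aut_orbitP H K :
  reflect (exists2 a, a \in Aut G & a @: H = K) ((K : {set gT}) \in Aut_orbit G H).
Proof.
have actE a : ('P^*)%act (H : {set gT}) a = a @: H by apply: eq_imset.
by apply: (iffP orbitP) => -[a Aa aH]; exists a; rewrite // -?aH ?actE // -actE.
Qed.

Lemma Aut_orbitE H K : H \subset G -> (K : {set gT}) \in Aut_orbit G H ->
  exists2 f : {morphism G >-> gT}, 'injm f /\ f @* G = G & f @* H = K.
Proof.
move=> sHG /Aut_orbitP[a Aa aH]; exists (autm Aa); first by rewrite injm_autm im_autm.
by rewrite morphimEsub.
Qed.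

Lemma isog_Aut_orbit H K : H \subset G -> (K : {set gT}) \in Aut_orbit G H -> H \isog K.
Proof.
move=> sHG /(Aut_orbitE sHG)[f [injf _] fH].
by have := sub_isog sHG injf; rewrite fH.
Qed.

Lemma card_subnorm_Aut_orbit H K : H \subset G ->
  (K : {set gT}) \in Aut_orbit G H -> #|'N_G(K)| = #|'N_G(H)|.
Proof.
move=> sHG /(Aut_orbitE sHG)[f [injf fG] fH].
by rewrite -fH -{1}fG -injm_subnorm // card_injm // subIset ?subxx.
Qed.

Lemma mem_Aut_orbit H K (f : {morphism G >-> gT}) : 'injm f -> f @* G = G ->
  H \subset G -> f @* H = K -> (K : {set gT}) \in Aut_orbit G H.
Proof.
move=> injf fG sHG fH; apply/Aut_orbitP; exists (aut injf fG).
  exact: Aut_aut.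
by rewrite imset_autE.
Qed.

End AutOrbits.

(** A name of its own lets pairs carry the twisted product below, in which [cT] translates the
    coordinates, instead of the direct product structure. *)
Definition wreath (gT cT : finGroupType) : Type := ({ffun cT -> gT} * cT)%type.

Section Wreath.

Variables gT cT : finGroupType.
Local Notation W := (wreath gT cT).

HB.instance Definition _ := Finite.on W.

Definition wr_mul (u v : W) : W := ([ffun x => u.1 x * v.1 (x * u.2)], u.2 * v.2).
Definition wr_one : W := ([ffun=> 1], 1).
Definition wr_inv (u : W) : W := ([ffun x => (u.1 (x * u.2^-1))^-1], u.2^-1).

Lemma wr_mulA : associative wr_mul.
Proof.
move=> u v w; congr (_, _); last exact: mulgA.
by apply/ffunP=> x; rewrite !ffunE !mulgA.
Qed.

Lemma wr_mul1 : left_id wr_one wr_mul.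
Proof.
case=> f a; congr (_, _); last exact: mul1g.
by apply/ffunP=> x; rewrite !ffunE mul1g mulg1.
Qed.

Lemma wr_mulV : left_inverse wr_one wr_inv wr_mul.
Proof.
move=> u; congr (_, _); last exact: mulVg.
by apply/ffunP=> x; rewrite !ffunE mulVg.
Qed.

HB.instance Definition _ := Finite_isGroup.Build W wr_mulA wr_mul1 wr_mulV.

Lemma wr_mul1E (u v : W) x : (u * v).1 x = u.1 x * v.1 (x * u.2).
Proof. exact: ffunE. Qed.

Lemma wr_mul2E (u v : W) : (u * v).2 = u.2 * v.2.
Proof. by []. Qed.

Lemma wr_one1E x : (1 : W).1 x = 1.
Proof. exact: ffunE. Qed.

Lemma wr_inv1E (u : W) x : (u^-1).1 x = (u.1 (x * u.2^-1))^-1.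
Proof. exact: ffunE. Qed.

Lemma wr_conj1E (u v : W) x : u.2 = 1 ->
  (u ^ v).1 x = u.1 (x * v.2^-1) ^ v.1 (x * v.2^-1).
Proof.
by move=> u2; rewrite !wr_mul1E wr_inv1E u2 mulg1 conjgE.
Qed.

Implicit Types H : cT -> {group gT}.

Definition wr_prod H : {set W} := [set u : W | (u.2 == 1) && [forall x, u.1 x \in H x]].

Lemma wr_prodP H (u : W) : reflect (u.2 = 1 /\ forall x, u.1 x \in H x) (u \in wr_prod H).
Proof.
by rewrite inE; apply: (iffP andP) => [[/eqP ? /forallP]|[-> Hu]]; split=> //; apply/forallP.
Qed.

Lemma group_set_wr_prod H : group_set (wr_prod H).
Proof.
apply/group_setP; split; first by apply/wr_prodP; split=> // x; rewrite wr_one1E group1.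
move=> u v /wr_prodP[u2 Hu] /wr_prodP[v2 Hv]; apply/wr_prodP.
split=> [|x]; first by rewrite wr_mul2E u2 v2 mulg1.
by rewrite wr_mul1E u2 mulg1 groupM.
Qed.
Canonical wr_prod_group H := Group (group_set_wr_prod H).

(** This single count gives the orders of products of subgroups, class sizes, normalisers of
    patterns and the order of the whole wreath product. *)
Lemma card_wr_pairs (F : cT -> {set gT}) (D : {set cT}) :
  #|[set u : W | (u.2 \in D) && [forall x, u.1 x \in F x]]| = (\prod_x #|F x| * #|D|)%N.
Proof.
rewrite (_ : [set _ | _] = setX [set f | f \in family F] D); last first.
  by apply/setP=> -[f a]; rewrite !inE andbC; congr (_ && _).
rewrite cardsX; congr (_ * _)%N.
by rewrite cardsE card_family foldrE big_map big_enum.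
Qed.

Lemma card_wr_prod H : #|wr_prod H| = (\prod_x #|H x|)%N.
Proof.
have := card_wr_pairs H [set 1]; rewrite cards1 muln1 => <-.
by apply: eq_card => u; rewrite !inE.
Qed.

Definition wr_base : {group W} := wr_prod_group (fun=> [set: gT]%G).

Lemma wr_baseP (u : W) : reflect (u.2 = 1) (u \in wr_base).
Proof. by apply: (iffP (wr_prodP _ _)) => [[]|u2] //; split=> // x; rewrite inE. Qed.

Lemma wr_prodS H1 H2 : (forall x, H1 x \subset H2 x) -> wr_prod H1 \subset wr_prod H2.
Proof.
move=> sH; apply/subsetP=> u /wr_prodP[u2 Hu]; apply/wr_prodP; split=> // x.
exact: subsetP (sH x) _ (Hu x).
Qed.

Lemma wr_prod_sub_base H : wr_prod H \subset wr_base.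
Proof. by apply: wr_prodS => x; rewrite subsetT. Qed.

Definition wr_single x (g : gT) : W := ([ffun y => if y == x then g else 1], 1).

Lemma wr_single_in H x g : g \in H x -> wr_single x g \in wr_prod H.
Proof.
move=> Hg; apply/wr_prodP; split=> // y; rewrite ffunE.
by case: eqP => [->|_] //; rewrite group1.
Qed.

Lemma wr_prod_inj H1 H2 : wr_prod H1 = wr_prod H2 -> forall x, H1 x = H2 x :> {set gT}.
Proof.
move=> eqH x; apply/eqP; rewrite eqEsubset; apply/andP; split;
  apply/subsetP=> g /wr_single_in; [rewrite eqH|rewrite -eqH];
  by move/wr_prodP=> [_ /(_ x)]; rewrite ffunE eqxx.
Qed.

Lemma wr_prodJ H (v : W) :
  wr_prod H :^ v = wr_prod (fun x => (H (x * v.2^-1)%g :^ v.1 (x * v.2^-1)%g)%G).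
Proof.
apply/eqP; rewrite eqEcard; apply/andP; split; last first.
  rewrite cardJg !card_wr_prod [X in (_ <= X)%N](reindex_inj (mulIg v.2^-1)) /=.
  by apply: eq_leq; apply: eq_bigr => x _; rewrite cardJg.
apply/subsetP=> _ /imsetP[u /wr_prodP[u2 Hu] ->]; apply/wr_prodP.
split=> [|x]; first by rewrite !wr_mul2E u2 mul1g mulVg.
by rewrite wr_conj1E // memJ_conjg.
Qed.

Definition wr_proj x (u : W) : gT := u.1 x.

Lemma wr_projM x : {in wr_base &, {morph wr_proj x : u v / u * v}}.
Proof. by move=> u v /wr_baseP u2 _; rewrite /wr_proj wr_mul1E u2 mulg1. Qed.
Canonical wr_proj_morphism x := Morphism (@wr_projM x).

Section PComplements.

Variable p : nat.
Hypotheses (pp : prime p) (pG : p %| #|[set: gT]|).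

Lemma p_nat_prod (I : finType) (m : I -> nat) :
  p.-nat (\prod_i m i)%N = [forall i, p.-nat (m i)].
Proof.
rewrite unlock; transitivity (all (fun i => p.-nat (m i)) (index_enum I)).
  by elim: index_enum => //= i s IH; rewrite pnatM IH.
by apply/allP/forallP => [a i|a i _]; [apply: a; rewrite mem_index_enum | apply: a].
Qed.

Lemma coprime_prod_eq (I : finType) (m : I -> nat) :
  coprime (\prod_i m i)%N p = [forall i, coprime (m i) p].
Proof.
rewrite unlock; transitivity (all (fun i => coprime (m i) p) (index_enum I)).
  by elim: index_enum => [|i s IH] /=; rewrite ?coprime1n // coprimeMl IH.
by apply/allP/forallP => [a i|a i _]; [apply: a; rewrite mem_index_enum | apply: a].
Qed.

Lemma indexg_wr_prod H : #|wr_base : wr_prod H| = (\prod_x #|[set: gT] : H x|)%N.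
Proof.
rewrite -divgS ?wr_prod_sub_base // !card_wr_prod /=.
have P0 : (0 < \prod_x #|H x|)%N by rewrite prodn_gt0.
apply/eqP; rewrite -(eqn_pmul2r P0) divnK; last first.
  by rewrite -!card_wr_prod cardSg // wr_prod_sub_base.
by rewrite -big_split /=; apply/eqP/eq_bigr=> x _; rewrite mulnC Lagrange ?subsetT.
Qed.

Lemma dvdn_card_wr_base : p %| #|wr_base|.
Proof. by rewrite card_wr_prod (bigD1 1) //= dvdn_mulr. Qed.

Lemma p_complement_wr_prod H :
  (forall x, p_complement p [set: gT] (H x)) -> p_complement p wr_base (wr_prod_group H).
Proof.
move=> pH; rewrite /p_complement pp dvdn_card_wr_base wr_prod_sub_base /=.
rewrite indexg_wr_prod p_nat_prod card_wr_prod coprime_prod_eq.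
by apply/andP; split; apply/forallP=> x; case/and5P: (pH x).
Qed.

(** K lies in the product of its projections. Its index there divides a power of p and also the
    order of the product, which is prime to p because each projection is a quotient of K; so the
    index is 1. *)
Lemma p_complement_wr_baseP (K : {group W}) : p_complement p wr_base K ->
  exists2 H, K = wr_prod H :> {set W} & forall x, p_complement p [set: gT] (H x).
Proof.
case/and5P=> _ _ sKB pK cK; pose H x := (wr_proj_morphism x @* K)%G.
have sKH : K \subset wr_prod H.
  apply/subsetP=> u Ku; have Bu := subsetP sKB u Ku.
  by apply/wr_prodP; split; [apply/wr_baseP | move=> x; apply: (mem_morphim _ Bu Ku)].
have cH x : coprime #|H x| p.
  by apply: coprime_dvdl cK; apply: dvdn_morphim.
have cP : coprime #|wr_prod H| p by rewrite card_wr_prod coprime_prod_eq; apply/forallP.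
have eqK : K = wr_prod H :> {set W}.
  apply/eqP; rewrite eqEsubset sKH -indexg_eq1; apply/eqP.
  apply: (@pnat_1 p).
    by apply: pnat_dvd pK; apply: indexSg => //; apply: wr_prod_sub_base.
  rewrite p'natE // -prime_coprime // coprime_sym.
  by apply: coprime_dvdl cP; apply: dvdn_indexg.
have pH : [forall x, p.-nat #|[set: gT] : H x|].
  by rewrite -p_nat_prod -indexg_wr_prod -eqK.
by exists H => // x; rewrite /p_complement pp pG subsetT cH andbT; apply: (forallP pH).
Qed.

(** Automorphisms of [gT], chosen separately in each coordinate, together form an automorphism of
    the base. *)
Lemma wr_base_p_complement_conj :
  (forall H K : {group gT}, p_complement p [set: gT] H -> p_complement p [set: gT] K ->
     (K : {set gT}) \in Aut_orbit [set: gT] H) ->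
  forall H K : {group W}, p_complement p wr_base H -> p_complement p wr_base K ->
     (K : {set W}) \in Aut_orbit wr_base H.
Proof.
move=> conjG H K /p_complement_wr_baseP[Hx defH pH] /p_complement_wr_baseP[Kx defK pK].
have /fin_all_exists[a aP] (x : cT) : exists b : {perm gT},
    b \in Aut [set: gT] /\ b @: Hx x = Kx x.
  by case/Aut_orbitP: (conjG _ _ (pH x) (pK x)) => b; exists b.
pose f (u : W) : W := ([ffun x => a x (u.1 x)], u.2).
have fM : {in wr_base &, {morph f : u v / u * v}}.
  move=> u v /wr_baseP u2 _; congr (_, _); apply/ffunP=> x; have [Aa _] := aP x.
  rewrite [in LHS]ffunE wr_mul1E [RHS]ffunE !ffunE /= u2 mulg1.
  by have := morphM (autm_morphism Aa) (in_setT (u.1 x)) (in_setT (v.1 x)).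
pose fm := Morphism fM.
have injf : 'injm fm.
  apply/injmP=> u v _ _ [/ffunP eq1 eq2]; rewrite [u]surjective_pairing [v]surjective_pairing.
  rewrite eq2; congr (_, _); apply/ffunP=> x; have := eq1 x; rewrite !ffunE.
  exact: perm_inj.
have sub_im : fm @* wr_base \subset wr_base.
  by apply/subsetP=> _ /morphimP[u _ /wr_baseP u2 ->]; apply/wr_baseP.
have fB : fm @* wr_base = wr_base.
  by apply/eqP; rewrite eqEcard sub_im card_injm ?leqnn ?subxx.
have sHB : H \subset wr_base by rewrite defH wr_prod_sub_base.
apply: (mem_Aut_orbit injf fB sHB); apply/eqP; rewrite eqEcard; apply/andP; split.
  rewrite defH defK; apply/subsetP=> _ /morphimP[u _ /wr_prodP[u2 Hu] ->].
  apply/wr_prodP; split=> // x; rewrite ffunE; have [_ <-] := aP x.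
  exact: imset_f.
rewrite card_injm // defH defK !card_wr_prod; apply: eq_leq; apply: eq_bigr => x _.
by have [_ <-] := aP x; rewrite card_imset //; apply: perm_inj.
Qed.

Variables A B : {group gT}.
Hypotheses (pA : p_complement p [set: gT] A) (pB : p_complement p [set: gT] B).

Definition wr_pattern (D : {set cT}) : {group W} :=
  wr_prod_group (fun x => if x \in D then A else B).

Lemma p_complement_wr_pattern D : p_complement p wr_base (wr_pattern D).
Proof. by apply: p_complement_wr_prod => x; case: ifP. Qed.

Hypothesis nconj : (A : {set gT}) \notin ((B : {set gT}) :^: [set: gT]).

Lemma nconjJ g : B :^ g <> A.
Proof. by move=> BgA; case/imsetP: nconj; exists g; rewrite ?inE. Qed.

Lemma nconjJ' g : A :^ g <> B.
Proof. by move=> BgA; apply: (@nconjJ g^-1); rewrite -BgA conjsgK. Qed.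

(** Conjugation by v translates coordinates by [v.2] and conjugates inside each of them. As A and B
    are not conjugate, the set of coordinates carrying A is translated along. *)
Lemma wr_pattern_conj_inj D E (v : W) :
  wr_pattern D :^ v = wr_pattern E -> forall x, (x \in D) = (x * v.2 \in E).
Proof.
rewrite wr_prodJ => /wr_prod_inj eqP x; have := eqP (x * v.2) => /=.
rewrite mulgK; case: (x \in D); case: (_ \in E) => //.
  by move/nconjJ'.
by move/nconjJ.
Qed.

(** Elements of the base do not move coordinates, so patterns on distinct sets are not conjugate;
    the singletons already give [#|cT|] classes. *)
Lemma card_p_complement_classes_wr_base : (#|cT| <= #|p_complement_classes p wr_base|)%N.
Proof.
pose h x := (wr_pattern [set x] : {set W}) :^: wr_base.
have injh : injective h.
  move=> x y hxy; have : (wr_pattern [set x] : {set W}) \in h y.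
    by rewrite -hxy; apply/imsetP; exists 1; rewrite ?conjsg1 ?group1.
  case/imsetP=> v /wr_baseP v2 /esym/wr_pattern_conj_inj/(_ y).
  by rewrite v2 mulg1 !inE eqxx => /esym/eqP.
rewrite -cardsT -(card_imset _ injh) subset_leq_card //.
apply/subsetP=> _ /imsetP[x _ ->]; apply/imsetP; exists (wr_pattern [set x]) => //.
by rewrite inE p_complement_wr_pattern.
Qed.

(** A normalising v must translate D to itself, and since 1 is in the subgroup D this means that
    [v.2] is in D. What remains is that each [v.1 x] normalises the factor at x. *)
Lemma card_subnorm_wr_pattern (D : {group cT}) :
  #|'N_[set: W](wr_pattern D)| = (\prod_x #|'N(if x \in D then A else B)| * #|D|)%N.
Proof.
rewrite setTI -(card_wr_pairs (fun x => 'N(if x \in D then A else B))%g).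
apply: eq_card => v; rewrite [in RHS]inE; apply/normP/andP=> [nv | [Dv /forallP nv]].
  have Dv : v.2 \in D.
    by have := wr_pattern_conj_inj nv 1; rewrite mul1g group1 => <-.
  split=> //; apply/forallP=> x; apply/normP.
  move: nv; rewrite wr_prodJ => /wr_prod_inj/(_ (x * v.2)) /=.
  by rewrite mulgK groupMr.
rewrite wr_prodJ; apply/setP=> u; rewrite !inE; congr (_ && _).
apply: eq_forallb => x /=; have := nv (x * v.2^-1).
by rewrite groupMr ?groupV // => /normP->.
Qed.

End PComplements.

End Wreath.

(** * Class sizes coprime to r *)

(** An isomorphism invariant; the order alone cannot separate p-complements of one group. *)
Definition r'_class_card (gT : finGroupType) (r : nat) (K : {group gT}) : nat :=
  #|[set x in K | ~~ (r %| #|x ^: K|)]|.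

Lemma isog_r'_class_card (aT rT : finGroupType) r (H : {group aT}) (K : {group rT}) :
  H \isog K -> r'_class_card r H = r'_class_card r K.
Proof.
case/isogP=> f injf fH; rewrite /r'_class_card.
rewrite -(card_injm injf) ?subsetIl //; last by apply/subsetP=> x; rewrite inE => /andP[].
apply: eq_card => y; rewrite inE -fH; apply/morphimP/andP => [[x Hx]|[]].
  rewrite inE Hx /= => ndv ->; split; first exact: mem_morphim.
  by rewrite -morphim_class // card_injm // class_subG.
case/morphimP=> x Hx _ -> ndv; exists x => //; rewrite inE Hx /=.
by rewrite -morphim_class // card_injm // class_subG in ndv.
Qed.

Lemma leq_card_isog_classes (gT : finGroupType) (p r n : nat) (G : {group gT})
    (K : 'I_n -> {group gT}) :
  (forall i, p_complement p G (K i)) ->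
  injective (fun i => r'_class_card r (K i)) ->
  (n <= #|p_complement_isog_classes p G|)%N.
Proof.
move=> pK injK; pose h i := [set H in p_complements p G | K i \isog H].
have injh : injective h.
  move=> i j eqh; apply: injK; apply: isog_r'_class_card.
  have : K j \in h i by rewrite eqh !inE pK isog_refl.
  by rewrite inE => /andP[].
rewrite -[n in (n <= _)%N]card_ord -cardsT -(card_imset _ injh) subset_leq_card //.
apply/subsetP=> _ /imsetP[i _ ->]; apply/imsetP; exists (K i) => //.
by rewrite inE pK.
Qed.

Section WreathClasses.

Variables (gT cT : finGroupType) (r : nat).
Hypothesis pr : prime r.

Lemma card_class_wr_prod (H : cT -> {group gT}) (u : wreath gT cT) : u \in wr_prod H ->
  #|u ^: wr_prod H| = (\prod_x #|u.1 x ^: H x|)%N.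
Proof.
case/wr_prodP=> u2 Hu.
have := card_wr_pairs (fun x => u.1 x ^: H x) [set 1]; rewrite cards1 muln1 => <-.
apply: eq_card => v; rewrite inE; apply/imsetP/andP.
  case=> w /wr_prodP[w2 Hw] ->; split.
    by rewrite inE !wr_mul2E u2 mul1g mulVg.
  apply/forallP=> x; rewrite wr_conj1E // w2 invg1 mulg1.
  by apply/imsetP; exists (w.1 x).
rewrite inE => -[/eqP v2 /forallP Hv].
have /fin_all_exists[g gP] x : exists g, g \in H x /\ v.1 x = u.1 x ^ g.
  by case/imsetP: (Hv x) => g; exists g.
exists ([ffun x => g x], 1); first by apply/wr_prodP; split=> // x; rewrite ffunE; case: (gP x).
rewrite [LHS]surjective_pairing [RHS]surjective_pairing; congr (_, _).
  by apply/ffunP=> x; rewrite wr_conj1E // invg1 mulg1 ffunE; case: (gP x).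
by rewrite !wr_mul2E u2 v2 mul1g mulVg.
Qed.

(** Class sizes multiply over the coordinates, and the prime r divides a product exactly when it
    divides a factor. *)
Lemma r'_class_card_wr_prod (H : cT -> {group gT}) :
  r'_class_card r (wr_prod_group H) = (\prod_x r'_class_card r (H x))%N.
Proof.
have := card_wr_pairs (fun x => [set y in H x | ~~ (r %| #|y ^: H x|)]) [set 1].
rewrite cards1 muln1 => <-; apply: eq_card => u.
rewrite !inE; have [/wr_prodP[u2 Hu]|nHu] := boolP (u \in wr_prod H).
  rewrite card_class_wr_prod ?u2 ?eqxx /=; last by apply/wr_prodP.
  rewrite -prime_coprime // coprime_sym coprime_prod_eq.
  have -> /= : [forall x, u.1 x \in H x] by apply/forallP.
  by apply: eq_forallb => x; rewrite inE Hu coprime_sym prime_coprime.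
move: nHu; rewrite inE /=; case: eqP => //= _ /negbTE nHu; rewrite nHu; apply/esym.
apply: contraFF nHu => /forallP Hu.
by apply/forallP=> x; have := Hu x; rewrite inE => /andP[].
Qed.

End WreathClasses.

(** * Wreath products by a p-group and counts of p-complements *)

Section WreathPGroup.

Variables (gT cT : finGroupType) (p : nat).
Hypotheses (pp : prime p) (pG : p %| #|[set: gT]|) (pC : p.-group [set: cT]).
Local Notation W := (wreath gT cT).

Lemma card_wreath : #|[set: W]| = (#|wr_base gT cT| * #|[set: cT]|)%N.
Proof.
rewrite card_wr_prod -card_wr_pairs; apply: eq_card => u; rewrite !inE.
by apply/esym/forallP=> x; rewrite inE.
Qed.

Lemma pnat_index_wr_base : p.-nat #|[set: W] : wr_base gT cT|.
Proof. by rewrite -divgS ?subsetT // card_wreath mulKn ?cardG_gt0. Qed.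

Lemma wr_expg2E (u : W) m : (u ^+ m).2 = u.2 ^+ m.
Proof. by elim: m => // m IH; rewrite !expgS wr_mul2E IH. Qed.

(** The order of [u.2] is a power of p and divides the order of K, so it is 1. *)
Lemma p'group_sub_wr_base (K : {group W}) : coprime #|K| p -> K \subset wr_base gT cT.
Proof.
move=> cK; apply/subsetP=> u Ku; apply/wr_baseP/eqP; rewrite -order_eq1; apply/eqP.
apply: (@pnat_1 p); first exact: mem_p_elt pC (in_setT _).
rewrite p'natE // -prime_coprime // coprime_sym; apply: coprime_dvdl cK.
by rewrite order_dvdn -wr_expg2E expg_cardG.
Qed.

Lemma p_complement_wreath (K : {group W}) :
  p_complement p [set: W] K = p_complement p (wr_base gT cT) K.
Proof.
rewrite /p_complement pp subsetT dvdn_card_wr_base // card_wreath.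
rewrite dvdn_mulr ?dvdn_card_wr_base //=; apply/andP/and3P => [[iK cK]|[sKB iK cK]].
  have sKB := p'group_sub_wr_base cK.
  by split=> //; apply: pnat_dvd iK; apply: indexSg sKB (subsetT _).
by rewrite -(Lagrange_index (subsetT _) sKB) pnatM pnat_index_wr_base.
Qed.

Variables A B : {group gT}.
Hypotheses (pA : p_complement p [set: gT] A) (pB : p_complement p [set: gT] B).

Lemma leq_card_Aut_orbits_wreath N :
  (A : {set gT}) \notin ((B : {set gT}) :^: [set: gT]) ->
  (B : {set gT}) \in Aut_orbit [set: gT] A -> #|[set: cT]| = (p ^ N)%N ->
  (N <= #|p_complement_Aut_orbits p [set: W]|)%N.
Proof.
move=> nconj AB cC.
have exD (j : 'I_N) : exists D : {group cT}, #|D| == (p ^ j)%N.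
  have [|D [_ _ cD]] := normal_pgroup pC (normal_refl _) (r := j).
    by rewrite cC pfactorK // ltnW.
  by exists D; apply/eqP.
pose D j := xchoose (exD j).
have cD j : #|D j| = (p ^ j)%N by apply/eqP: (xchooseP (exD j)).
pose K j := wr_pattern A B (D j).
(* An automorphism carries A to B, so their normalisers have equal order and the first factor does
   not depend on [D j]. *)
have cN j : #|'N_[set: W](K j)| = (#|'N(A)| ^ #|cT| * p ^ j)%N.
  rewrite card_subnorm_wr_pattern // cD; congr (_ * _)%N.
  rewrite -prod_nat_const; apply: eq_bigr => x _; case: ifP => // _.
  by have := card_subnorm_Aut_orbit (subsetT A) AB; rewrite !setTI.
pose h j := Aut_orbit [set: W] (K j).
have injh : injective h.
  move=> i j hij; have : (K i : {set W}) \in h j by rewrite -hij; apply: orbit_refl.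
  move/(card_subnorm_Aut_orbit (subsetT _))/eqP; rewrite !cN.
  rewrite eqn_pmul2l ?expn_gt0 ?cardG_gt0 //.
  by rewrite eqn_exp2l ?prime_gt1 // => /eqP/val_inj.
rewrite -[N in (N <= _)%N]card_ord -cardsT -(card_imset _ injh) subset_leq_card //.
apply/subsetP=> _ /imsetP[j _ ->]; apply/imsetP; exists (K j) => //.
by rewrite inE p_complement_wreath p_complement_wr_pattern.
Qed.

Lemma leq_card_isog_classes_wr_base r N : prime r ->
  (0 < r'_class_card r A < r'_class_card r B)%N -> (N <= #|cT|)%N ->
  (N <= #|p_complement_isog_classes p (wr_base gT cT)|)%N.
Proof.
move=> pr /andP[A0 AB] NC.
(* Any set of j coordinates serves; the enumeration of [cT] supplies one. *)
pose D (j : 'I_N) := [set x : cT | (enum_rank x < j)%N].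
have cD j : #|D j| = j.
  rewrite -(card_imset _ enum_rank_inj) -[RHS](card_ord j).
  have jC : (j <= #|cT|)%N := leq_trans (ltnW (ltn_ord j)) NC.
  have winj : injective (widen_ord jC) by move=> x y [] /val_inj.
  rewrite -[RHS](card_imset _ winj).
  apply: eq_card => i; apply/imsetP/imsetP => [[x]|[y _ ->]].
    by rewrite inE => lti ->; exists (Ordinal lti) => //; apply: val_inj.
  by exists (enum_val (widen_ord jC y)); rewrite ?inE enum_valK //= ltn_ord.
apply: (@leq_card_isog_classes _ p r N _ (fun j => wr_pattern A B (D j))) => [j|i j].
  exact: p_complement_wr_pattern.
have E (l : 'I_N) : r'_class_card r (wr_pattern A B (D l)) =
    (r'_class_card r A ^ l * r'_class_card r B ^ (#|cT| - l))%N.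
  rewrite r'_class_card_wr_prod // (bigID (mem (D l))) /=; congr (_ * _)%N.
    by rewrite -[in RHS](cD l) -prod_nat_const; apply: eq_bigr => x ->.
  rewrite -[in RHS](cD l) -(cardC (mem (D l))) addKn -prod_nat_const.
  by apply: eq_big => x; rewrite ?inE // => /negbTE ->.
rewrite !E; set a := r'_class_card r A in A0 AB *; set b := r'_class_card r B in AB *.
(* With c coordinates, a^j b^(c - j) strictly decreases in j because 0 < a < b, so the invariants
   are distinct. *)
have lt (i' j' : 'I_N) : (i' < j')%N ->
    (a ^ j' * b ^ (#|cT| - j') < a ^ i' * b ^ (#|cT| - i'))%N.
  move=> ij; have jC : (j' <= #|cT|)%N := leq_trans (ltnW (ltn_ord j')) NC.
  rewrite -{1}(subnKC (ltnW ij)) expnD -mulnA ltn_pmul2l ?expn_gt0 ?A0 //.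
  rewrite (_ : #|cT| - i' = (j' - i') + (#|cT| - j'))%N; last by clear -ij jC; lia.
  rewrite expnD ltn_pmul2r ?expn_gt0 ?(ltn_trans A0) // ltn_exp2r // subn_gt0.
  exact: ij.
by case: (ltngtP i j) => [/lt|/lt|/val_inj //]; [move=> + E'|move=> + E']; rewrite E' ltnn.
Qed.

End WreathPGroup.

(** * Lines, hyperplanes and transvections *)

Lemma p_complement_injm (gT : finGroupType) p (G H : {group gT}) (f : {morphism G >-> gT}) :
  'injm f -> f @* G = G -> p_complement p G H -> p_complement p G (f @* H)%G.
Proof.
move=> injf fG /and5P[pp pG sHG iH cH]; rewrite /p_complement pp pG /=.
have sfHG : f @* H \subset G by have := morphimS f sHG; rewrite fG.
by rewrite sfHG -divgS // !card_injm // divgS // iH.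
Qed.

(* Sylow's theorem in H gives Sylow r-subgroups of G, as p <> r. *)
Lemma p_complement_conj_pgroup (gT : finGroupType) p r (G H R : {group gT}) :
  prime r -> r != p -> p_complement p G H -> R \subset G -> r.-group R ->
  exists2 g, g \in G & R :^ g \subset H.
Proof.
move=> pr rp /and5P[pp pG sHG iH cH] sRG rR.
have [S sylS] := Sylow_exists r H.
have sylG : r.-Sylow(G) S.
  rewrite pHallE (subset_trans (pHall_sub sylS)) //= (card_Hall sylS).
  have r'iH : r^'.-nat #|G : H|.
    by apply: sub_in_pnat iH => s _; rewrite !inE => /eqP ->; rewrite eq_sym.
  by rewrite -(Lagrange sHG) partnM ?cardG_gt0 // (part_p'nat r'iH) muln1.
have [x Gx sRS] := Sylow_Jsub sylG sRG rR.
by exists x => //; apply: subset_trans sRS (pHall_sub sylS).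
Qed.

Definition gl_type (F : finFieldType) (n : nat) : finGroupType := {'GL_n.+1[F]}.

Section GL.

Local Open Scope ring_scope.

Variables (F : finFieldType) (n : nat).
Local Notation d := n.+1.
Local Notation L := (gl_type F n).
Local Notation q := #|F|.

Definition mx (g : L) : 'M[F]_d := GLval g.

Lemma mx_inj : injective mx. Proof. exact: val_inj. Qed.
Lemma mxM (g h : L) : mx (g * h)%g = mx g *m mx h. Proof. by []. Qed.
Lemma mx1 : mx 1%g = 1%:M. Proof. by []. Qed.
Lemma mxV (g : L) : mx g^-1%g = invmx (mx g). Proof. by []. Qed.
Lemma mx_unit (g : L) : mx g \in unitmx. Proof. exact: (GL_unitmx g). Qed.

Lemma mx_exists (A : 'M[F]_d) : A \in unitmx -> exists g : L, mx g = A.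
Proof. by move=> uA; exists (FinRing.Unit uA). Qed.

Lemma mxKV (v : 'rV[F]_d) (g : L) : v *m mx g *m mx g^-1%g = v.
Proof. by rewrite mxV mulmxK // mx_unit. Qed.

Lemma mxVK (v : 'rV[F]_d) (g : L) : v *m mx g^-1%g *m mx g = v.
Proof. by rewrite mxV mulmxKV // mx_unit. Qed.

Lemma mulmx_GL_eq0 (v : 'rV[F]_d) (g : L) : (v *m mx g == 0) = (v == 0).
Proof. by apply/eqP/eqP => [vg|->]; rewrite ?mul0mx // -(mxKV v g) vg mul0mx. Qed.

Lemma GL_transitive (v w : 'rV[F]_d) : v != 0 -> w != 0 -> exists g : L, v *m mx g = w.
Proof.
have base (x : 'rV[F]_d) : x != 0 -> exists g : L, (delta_mx 0 0 : 'rV_d) *m mx g = x.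
  move=> x0; have rx : \rank x = 1%N by rewrite rank_rV x0.
  (* For a row of rank 1 the rank decomposition reads x = c e R, with c a nonzero scalar, e the
     first unit row and R invertible; thus c R sends e to x. *)
  have := mulmx_ebase x; rewrite rx [col_ebase x]mx11_scalar.
  set c := col_ebase x 0 0 => xE.
  have c0 : c != 0 by apply: contraNneq x0 => c0; rewrite -xE c0 raddf0 !mul0mx.
  have uc : c *: row_ebase x \in unitmx by rewrite unitmxZ ?row_ebase_unit // unitfE.
  have [g gE] := mx_exists uc.
  exists g; rewrite gE -[RHS]xE mul_scalar_mx -scalemxAr -scalemxAl; congr (_ *: (_ *m _)).
  by apply/matrixP=> i j; rewrite !mxE !ord1 eqxx andbT eq_sym.
move=> /base[g <-] /base[h <-]; exists (g^-1 * h)%g.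
by rewrite mxM mulmxA mxKV.
Qed.

Definition line_stab (v : 'rV[F]_d) : {set L} := [set g | (v *m mx g <= v)%MS].
(** Matrices act on rows from the right, so a nonzero column w stands for the hyperplane of rows u
    with u w = 0, and fixing w up to a scalar is fixing that hyperplane. The transposes are there
    because [<=] compares row spaces. *)
Definition coline_stab (w : 'cV[F]_d) : {set L} := [set g | ((mx g *m w)^T <= w^T)%MS].

Lemma group_set_line_stab v : group_set (line_stab v).
Proof.
apply/group_setP; split=> [|g h]; first by rewrite inE mx1 mulmx1.
rewrite !inE mxM mulmxA => vg vh; apply: submx_trans vh; exact: submxMr.
Qed.
Canonical line_stab_group v := Group (group_set_line_stab v).

Lemma group_set_coline_stab w : group_set (coline_stab w).
Proof.
apply/group_setP; split=> [|g h]; first by rewrite inE mx1 mul1mx.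
rewrite !inE mxM -mulmxA => wg wh; rewrite trmx_mul.
by apply: submx_trans wg; rewrite [X in (_ <= X)%MS]trmx_mul submxMr.
Qed.
Canonical coline_stab_group w := Group (group_set_coline_stab w).

Lemma line_stabJ v (g : L) : line_stab v :^ g = line_stab (v *m mx g).
Proof.
apply/setP=> h; rewrite mem_conjg [LHS]inE [RHS]inE.
have -> : mx (h ^ g^-1)%g = mx g *m mx h *m mx g^-1%g by rewrite conjgE invgK mulgA.
rewrite !mulmxA.
apply/idP/idP => [/(submxMr (mx g))|/(submxMr (mx g^-1%g))].
  by rewrite mxVK.
by rewrite mxKV.
Qed.

Lemma contragr_unit (g : L) : (mx g^-1%g)^T \in unitmx.
Proof. by rewrite unitmx_tr mx_unit. Qed.

Definition contragr (g : L) : L := FinRing.Unit (contragr_unit g).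

Lemma mx_contragr g : mx (contragr g) = (mx g^-1%g)^T.
Proof. by []. Qed.

Lemma contragrM : {in [set: L] &, {morph contragr : g h / (g * h)%g}}.
Proof.
move=> g h _ _; apply: mx_inj.
by rewrite mxM !mx_contragr invMg mxM trmx_mul.
Qed.
Canonical contragr_morphism := Morphism contragrM.

Lemma contragrK : involutive contragr.
Proof.
move=> g; apply: mx_inj; rewrite mx_contragr mxV mx_contragr mxV.
by rewrite -trmx_inv trmxK invmxK.
Qed.

Lemma injm_contragr : 'injm contragr_morphism.
Proof. by apply/injmP=> g h _ _; apply: can_inj contragrK g h. Qed.

Lemma im_contragr : contragr_morphism @* [set: L] = [set: L].
Proof. by apply/eqP; rewrite eqEcard subsetT card_injm ?injm_contragr /=. Qed.

Lemma mem_contragr (A : {set L}) g : (contragr g \in contragr_morphism @* A) = (g \in A).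
Proof.
apply/morphimP/idP => [[h _ Ah /(can_inj contragrK) ->] // | Ag].
by exists g; rewrite ?inE.
Qed.

Lemma contragr_line_stab v : contragr_morphism @* line_stab v = coline_stab v^T.
Proof.
apply/setP=> g; rewrite -[g]contragrK mem_contragr -groupV !inE mx_contragr.
by rewrite trmx_mul !trmxK.
Qed.

(** The group of all maps u |-> u + (u phi) v with phi a linear form vanishing on the centre v, the
    identity included. *)
Definition transvections (v : 'rV[F]_d) : {set L} :=
  [set g | [exists phi : 'cV_d, (v *m phi == 0) && (mx g == 1%:M + phi *m v)]].

Lemma transvectionsP v (g : L) :
  reflect (exists2 phi : 'cV_d, v *m phi = 0 & mx g = 1%:M + phi *m v)
          (g \in transvections v).
Proof.
rewrite inE; apply: (iffP existsP) => [[phi /andP[/eqP ? /eqP ?]]|[phi v0 gE]].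
  by exists phi.
by exists phi; rewrite v0 gE !eqxx.
Qed.

Lemma transvection_mul m (u : 'M[F]_(m, d)) (phi psi : 'M[F]_(d, m)) :
  (1%:M + psi *m u) *m (1%:M + phi *m u) = 1%:M + (psi + phi) *m u + psi *m (u *m phi) *m u.
Proof.
rewrite mulmxDl mul1mx mulmxDr mulmx1 mulmxDl -!mulmxA.
by rewrite -!addrA; congr (_ + _); rewrite addrCA addrA.
Qed.

(** Since u phi = 0, the two matrices are mutually inverse. The general m allows blocks of higher
    rank, needed for the coset count of an invariant subspace. *)
Lemma transvection_exists m (u : 'M[F]_(m, d)) (phi : 'M[F]_(d, m)) : u *m phi = 0 ->
  exists2 g : L, mx g = 1%:M + phi *m u & mx g^-1%g = 1%:M - phi *m u.
Proof.
move=> u0.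
have E : (1%:M + phi *m u) *m (1%:M - phi *m u) = 1%:M.
  rewrite -mulNmx transvection_mul // mulmxN u0 oppr0 mulmx0 mul0mx addr0.
  by rewrite subrr mul0mx addr0.
have [uA uB] := mulmx1_unit E.
have [g gE] := mx_exists uA; exists g => //.
by rewrite mxV gE -[RHS](mulKmx uA) E mulmx1.
Qed.

Lemma group_set_transvections v : group_set (transvections v).
Proof.
apply/group_setP; split=> [|g h].
  by apply/transvectionsP; exists 0; rewrite ?mulmx0 // mul0mx addr0 mx1.
case/transvectionsP=> psi v0 gE /transvectionsP[phi v1 hE]; apply/transvectionsP.
exists (psi + phi); first by rewrite mulmxDr v0 v1 addr0.
by rewrite mxM gE hE transvection_mul // v1 mulmx0 mul0mx addr0.
Qed.
Canonical transvections_group v := Group (group_set_transvections v).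

Lemma transvectionsJ v (g : L) : transvections v :^ g = transvections (v *m mx g).
Proof.
have sub v' (h : L) : transvections v' :^ h \subset transvections (v' *m mx h).
  apply/subsetP=> _ /imsetP[x /transvectionsP[phi v0 xE] ->]; apply/transvectionsP.
  exists (mx h^-1%g *m phi); first by rewrite mulmxA mxKV.
  rewrite conjgE !mxM xE mulmxDl mulmxDr mul1mx !mulmxA; congr (_ + _).
  by rewrite -mxM mulVg mx1.
apply/eqP; rewrite eqEsubset sub /= -sub_conjgV.
by rewrite (subset_trans (sub _ _)) // mxKV.
Qed.

Lemma transvections_line_stab v : transvections v \subset line_stab v.
Proof.
apply/subsetP=> g /transvectionsP[phi v0 gE].
by rewrite inE gE mulmxDr mulmx1 mulmxA v0 mul0mx addr0.
Qed.

(** The inverse transpose of 1 + w u is 1 - u^T w^T: transvections with axis w become transvections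
    with centre w^T. *)
Lemma contragr_transvection (w : 'cV[F]_d) (u : 'rV[F]_d) (g : L) :
  u *m w = 0 -> mx g = 1%:M + w *m u -> g \in contragr_morphism @* transvections w^T.
Proof.
move=> u0 gE; rewrite -[g]contragrK mem_contragr.
have [h hE hV] := transvection_exists u0.
have -> : g = h by apply: mx_inj; rewrite gE hE.
apply/transvectionsP; exists (- u^T); first by rewrite mulmxN -trmx_mul u0 trmx0 oppr0.
by rewrite mx_contragr hV linearB /= trmx1 trmx_mul mulNmx.
Qed.

End GL.

Arguments mx {F n} g : simpl never.

(** * p-complements of the general linear group *)

Section PCompl.
Variables (gT : finGroupType) (p : nat) (G : {group gT}).

Lemma index_p_complement (H : {group gT}) : p_complement p G H -> #|G : H| = (#|G|`_p)%N.
Proof.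
case/and5P=> pp _ sHG iH cH; rewrite -(Lagrange sHG) partnM ?cardG_gt0 //.
rewrite (part_pnat_id iH) part_p'nat ?mul1n // p'natE //.
by rewrite -prime_coprime // coprime_sym.
Qed.

Lemma p_complement_eq (H K : {group gT}) :
  p_complement p G H -> p_complement p G K -> H \subset K -> H :=: K.
Proof.
move=> pH pK sHK; apply/eqP; rewrite eqEsubset sHK -indexg_eq1.
have [_ _ sKG _ _] := and5P pK.
have := Lagrange_index sKG sHK; rewrite !index_p_complement //.
by rewrite -[RHS]muln1 => /eqP; rewrite eqn_pmul2l ?part_gt0.
Qed.
End PCompl.

Section Counting.

Local Open Scope ring_scope.

Variables (F : finFieldType) (n : nat).
Local Notation d := n.+1.
Local Notation L := (gl_type F n).
Local Notation q := #|F|.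

Lemma card_rows_neq0 : #|[set w : 'rV[F]_d | w != 0]| = (q ^ d - 1)%N.
Proof.
rewrite (_ : [set _ | _] = ~: [set 0]); last by apply/setP=> w; rewrite !inE.
by rewrite cardsCs setCK cards1 card_mx mul1n.
Qed.

Lemma card_line_neq0 (v : 'rV[F]_d) : v != 0 ->
  #|[set w : 'rV[F]_d | (w != 0) && (w <= v)%MS]| = (q - 1)%N.
Proof.
move=> v0; rewrite (_ : [set _ | _] = [set c *: v | c in [set~ 0]]); last first.
  apply/setP=> w; rewrite inE; apply/andP/imsetP => [[w0 /sub_rVP[c wE]]|[c c0 ->]].
    by exists c => //; rewrite !inE; apply: contraNneq w0 => c0; rewrite wE c0 scale0r.
  by rewrite scaler_eq0 negb_or v0 andbT scalemx_sub //; move: c0; rewrite !inE.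
rewrite card_imset; first by rewrite cardsCs setCK cards1.
move=> a b /eqP; rewrite -subr_eq0 -scalerBl scaler_eq0 (negPf v0) orbF subr_eq0.
by move/eqP.
Qed.

(** The fibres of g |-> v g over B are cosets of the stabiliser of the vector v, by transitivity on
    nonzero rows. *)
Lemma card_GL_rows (v : 'rV[F]_d) (A : {set L}) (B : {set 'rV[F]_d}) :
  v != 0 -> 0 \notin B -> (forall g, (g \in A) = (v *m mx g \in B)) ->
  #|A| = (#|B| * #|[set g : L | v *m mx g == v]|)%N.
Proof.
move=> v0 B0 AB; rewrite -sum1_card (partition_big (fun g => v *m mx g) (mem B)) /=; last first.
  by move=> g; rewrite AB.
rewrite -sum_nat_const; apply: eq_bigr => w Bw.
have w0 : w != 0 by apply: contraNneq B0 => <-.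
have [h hE] := GL_transitive v0 w0.
rewrite sum1dep_card -[RHS](card_imset _ (mulIg h)); apply: eq_card => g.
rewrite inE AB; apply/andP/imsetP => [[_ /eqP gE]|[x]].
  exists (g * h^-1)%g; last by rewrite mulgKV.
  by rewrite inE mxM mulmxA gE -hE mxKV.
by rewrite inE => /eqP xE ->; rewrite mxM mulmxA xE hE.
Qed.

Lemma card_line_stab (v : 'rV[F]_d) : v != 0 ->
  (#|line_stab v| * (q ^ d - 1) = #|[set: L]| * (q - 1))%N.
Proof.
move=> v0; rewrite (card_GL_rows (A := [set: L]) (B := [set w | w != 0]) v0); first last.
- by move=> g; rewrite !inE mulmx_GL_eq0 v0.
- by rewrite inE eqxx.
rewrite (card_GL_rows (A := line_stab v) (B := [set w : 'rV[F]_d | (w != 0) && (w <= v)%MS]) v0).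
- by rewrite card_line_neq0 // card_rows_neq0; ring.
- by rewrite inE eqxx.
by move=> g; rewrite inE [RHS]inE mulmx_GL_eq0 v0.
Qed.

Variables (p k r : nat).
Hypotheses (pp : prime p) (n2 : (1 < n)%N) (qd : geom_sum q d = (p ^ k)%N).
Hypotheses (charF : r \in [pchar F]).

Let q1 : (1 < q)%N. Proof. exact: finNzRing_gt1. Qed.
Let q0 : (0 < q)%N := ltnW q1.
Let pr : prime r := pcharf_prime charF.

Let k0 : (0 < k)%N.
Proof.
have := @ltn_geom_sum q d q0 (ltnW n2 : (1 < d)%N); rewrite qd.
by case: k => //; rewrite expn0 ltnS leqNgt q0.
Qed.

Lemma card_line_stabM (v : 'rV[F]_d) : v != 0 -> (#|line_stab v| * p ^ k = #|[set: L]|)%N.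
Proof.
move/card_line_stab; rewrite -geom_sumE qd mulnCA mulnC => /eqP.
by rewrite eqn_pmul2r ?subn_gt0 // => /eqP.
Qed.

(** In the order formula for GL_d the last factor q^d - 1 equals (q - 1) p^k. Cancelling the index
    p^k leaves a power of q and factors q^i - 1 with 0 < i < d, all prime to p. *)
Lemma coprime_card_line_stab (v : 'rV[F]_d) : v != 0 -> coprime #|line_stab v| p.
Proof.
move=> v0; have := card_line_stabM v0.
have -> : #|[set: L]| = (q ^ 'C(d, 2) * \prod_(1 <= i < d.+1) (q ^ i - 1))%N.
  exact: (@card_GL F d isT).
rewrite big_nat_recr //= -geom_sumE qd !mulnA => /eqP.
rewrite eqn_pmul2r ?expn_gt0 ?prime_gt0 // => /eqP ->.
have cqp : coprime q p by rewrite coprime_sym; apply: repunit_coprime (ltnW n2 : (1 < d)%N) q0 qd.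
have npi := repunit_prime_power_order pp q1 (n2 : (2 < d)%N) qd.
rewrite !coprimeMl (coprimeXl _ cqp) /=; apply/andP; split; last first.
  by rewrite coprime_sym prime_coprime // -[X in (X - _)%N]expn1 npi //= ltnS ltnW.
rewrite big_nat; elim/big_ind: _ => [|a b ca cb|i /andP[i0 id]].
- exact: coprime1n.
- by rewrite coprimeMl ca.
by rewrite coprime_sym prime_coprime // npi // i0.
Qed.

Lemma p_complement_line_stab (v : 'rV[F]_d) : v != 0 ->
  p_complement p [set: L] (line_stab_group v).
Proof.
move=> v0; rewrite /p_complement pp subsetT coprime_card_line_stab // -(card_line_stabM v0).
rewrite dvdn_mull ?dvdn_exp //= -divgS ?subsetT // -(card_line_stabM v0).
by rewrite mulKn ?cardG_gt0 // pnatX pnat_id.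
Qed.

Lemma p_complement_coline_stab (w : 'cV[F]_d) : w != 0 ->
  p_complement p [set: L] (coline_stab_group w).
Proof.
move=> w0; have wT0 : w^T != 0 by rewrite -(inj_eq trmx_inj) trmxK trmx0.
have := p_complement_injm (injm_contragr _ _) (im_contragr F n) (p_complement_line_stab wT0).
by congr p_complement; apply/val_inj; rewrite /= contragr_line_stab trmxK.
Qed.

(** The j-th power of 1 + phi v is 1 + j phi v, so every element has order dividing r; Cauchy's
    theorem excludes other primes. *)
Lemma pgroup_transvections (v : 'rV[F]_d) : r.-group (transvections v).
Proof.
apply/pgroupP=> s ps /(Cauchy ps)[g /transvectionsP[phi v0 gE] os].
have gX j : mx (g ^+ j)%g = 1%:M + (phi *+ j) *m v.
  elim: j => [|j IH]; first by rewrite mulr0n mul0mx addr0.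
  rewrite expgS mxM gE IH transvection_mul mulrS.
  by rewrite -scaler_nat -[v *m _]scalemxAr v0 scaler0 mulmx0 mul0mx addr0.
have : (g ^+ r)%g = 1%g.
  apply: mx_inj; rewrite gX -scaler_nat pcharf0 // scale0r mul0mx addr0; exact: mx1.
move/eqP; rewrite -order_dvdn os => sr; rewrite inE.
by rewrite /= -(dvdn_prime2 ps pr).
Qed.

Section Classification.

(** Here r differs from p because r divides q and p does not. So K contains a conjugate of the
    r-group of transvections with a given centre, and that conjugate is again of this form. *)
Lemma p_complement_center (K : {group L}) : p_complement p [set: L] K ->
  exists2 v : 'rV[F]_d, v != 0 & transvections v \subset K.
Proof.
move=> pK; have rp : r != p.
  have rq : (r %| q)%N.
    have := abelem_pgroup (fin_ring_pchar_abelem charF).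
    rewrite /pgroup cardsT => /p_natP[e qE].
    by move: q1; rewrite qE; case: e {qE} => // e _; rewrite dvdn_exp.
  apply: contraTneq rq => ->; rewrite -prime_coprime //.
  exact: repunit_coprime pp (ltnW n2 : (1 < d)%N) q0 qd.
pose v0 : 'rV[F]_d := delta_mx 0 0.
have v00 : v0 != 0.
  by apply/eqP=> /rowP/(_ 0); rewrite !mxE !eqxx => /eqP; rewrite oner_eq0.
have [g _ sgK] := p_complement_conj_pgroup pr rp pK (subsetT _) (pgroup_transvections v0).
by exists (v0 *m mx g); rewrite ?mulmx_GL_eq0 // -transvectionsJ.
Qed.

Variable H : {group L}.
Hypothesis pH : p_complement p [set: L] H.

(** This is the existence of a centre, applied to the image of H under the inverse transpose. *)
Lemma p_complement_axis : exists2 w : 'cV[F]_d, w != 0 &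
  forall (u : 'rV[F]_d) (g : L), u *m w = 0 -> mx g = 1%:M + w *m u -> g \in H.
Proof.
have [v v0 sv] := p_complement_center (p_complement_injm (injm_contragr _ _) (im_contragr F n) pH).
exists v^T; first by rewrite -(inj_eq trmx_inj) trmxK trmx0.
move=> u g u0 gE; rewrite -mem_contragr; apply: (subsetP sv).
by rewrite -[v]trmxK -mem_contragr contragrK; apply: contragr_transvection u0 gE.
Qed.

Lemma center_sub_axis (v : 'rV[F]_d) (w : 'cV[F]_d) : v != 0 -> w != 0 ->
  transvections v \subset H ->
  (forall (u : 'rV[F]_d) (g : L), u *m w = 0 -> mx g = 1%:M + w *m u -> g \in H) ->
  v *m w = 0.
Proof.
move=> v0 w0 sv sw; apply/eqP/negPn/negP => vw0.
pose s := (v *m w) 0 0.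
have vwE : v *m w = s%:M by rewrite [LHS]mx11_scalar.
have s0 : s != 0 by apply: contraNneq vw0 => s0; rewrite vwE s0 raddf0.
(* A row off the hyperplane is moved into the line of v by one transvection 1 + w u of axis w: u is
   solved from x + a u = (a / s) v, where a = x w and s = v w. *)
have off (x : 'rV_d) : x *m w != 0 -> exists2 h : L, h \in H & (x *m mx h <= v)%MS.
  move=> xw0; pose a := (x *m w) 0 0.
  have xwE : x *m w = a%:M by rewrite [LHS]mx11_scalar.
  have a0 : a != 0 by apply: contraNneq xw0 => a0; rewrite xwE a0 raddf0.
  pose u := a^-1 *: ((a / s) *: v - x).
  have uw : u *m w = 0.
    rewrite -scalemxAl mulmxBl -scalemxAl vwE xwE.
    by rewrite scale_scalar_mx divfK // subrr scaler0.
  have [h hE _] := transvection_exists uw.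
  exists h; first exact: sw uw hE.
  rewrite hE mulmxDr mulmx1 mulmxA xwE mul_scalar_mx scalerA divff // scale1r.
  by rewrite addrC subrK scalemx_sub.
have all_x (x : 'rV_d) : x != 0 -> exists2 h : L, h \in H & (x *m mx h <= v)%MS.
  move=> x0; have [xw|] := eqVneq (x *m w) 0; last exact: off.
  have [psi psiE] : exists B : 'cV_d, x *m B = 1%:M.
    by apply/row_freeP; rewrite /row_free rank_rV x0.
  (* For x on the hyperplane, a transvection of centre v first moves x to x + v, which is off it.
     The correction of psi by a multiple of w makes phi vanish on v and keeps its value 1 at x, as x
     w = 0. *)
  pose phi := psi - w *m (s^-1 *: (v *m psi)).
  have vphi : v *m phi = 0.
    by rewrite mulmxBr mulmxA vwE mul_scalar_mx scalerA divff // scale1r subrr.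
  have xphi : x *m phi = 1%:M by rewrite mulmxBr mulmxA xw mul0mx subr0.
  have [h hE _] := transvection_exists vphi.
  have Hh : h \in H by apply: (subsetP sv); apply/transvectionsP; exists phi.
  have [h' Hh' xh] : exists2 h' : L, h' \in H & ((x + v) *m mx h' <= v)%MS.
    by apply: off; rewrite mulmxDl xw add0r.
  exists (h * h')%g; first exact: groupM.
  by rewrite mxM mulmxA hE mulmxDr mulmx1 mulmxA xphi mul1mx.
have LE : (line_stab v * H)%g = [set: L].
  apply/eqP; rewrite eqEsubset subsetT; apply/subsetP=> g _.
  have [|h Hh vgh] := all_x (v *m mx g); first by rewrite mulmx_GL_eq0.
  apply/mulsgP; exists (g * h)%g h^-1%g; rewrite ?groupV //; last by rewrite mulgK.
  by rewrite inE mxM mulmxA.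
(* As [line_stab v] has index p^k, the factorisation gives that the order of H is p^k times that of
   the intersection. *)
have := mul_cardG (line_stab_group v) H; rewrite /= LE -(card_line_stabM v0) -mulnA => /eqP.
rewrite eqn_pmul2l ?cardG_gt0 // => /eqP HE.
case/and5P: pH => _ _ _ _; rewrite coprime_sym prime_coprime // HE.
by rewrite dvdn_mulr // dvdn_exp.
Qed.

(* The matrices 1 + rho B sigma, with S rho = 1 and sigma rho = 0, lie in distinct cosets of H. *)
Lemma leq_card_invariant_subspace m (S : 'M[F]_(m, d)) :
  (forall h, h \in H -> (S *m mx h <= S)%MS) ->
  (q ^ (\rank S * (d - \rank S)) <= p ^ k)%N.
Proof.
move=> SH; pose S0 := row_base S.
have S0H h : h \in H -> (S0 *m mx h <= S0)%MS.
  by move=> Hh; rewrite eq_row_base (eqmxMr _ (eq_row_base S)) SH.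
have [rho rhoE] : exists B, S0 *m B = 1%:M by apply/row_freeP/row_base_free.
have rk_rho : \rank rho = \rank S.
  apply/eqP; rewrite eqn_leq rank_leq_col /=.
  by rewrite -[X in (X <= _)%N](mxrank1 F) -rhoE mxrankM_maxr.
pose sigma := row_base (kermx rho).
have sr : sigma *m rho = 0 by apply/sub_kermxP; rewrite eq_row_base.
have rk_sigma : \rank (kermx rho) = (d - \rank S)%N by rewrite mxrank_ker rk_rho.
have /fin_all_exists[g gP] (B : 'M[F]_(\rank S, \rank (kermx rho))) : exists h : L,
    mx h = 1%:M + rho *m (B *m sigma) /\ mx h^-1%g = 1%:M - rho *m (B *m sigma).
  have [|h hE hV] := @transvection_exists F n _ (B *m sigma) rho.
    by rewrite -mulmxA sr mulmx0.
  by exists h.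
(* If B and C give the same coset, then S0 + (B - C) sigma lies in S0, so (B - C) sigma = X S0;
   multiplying by rho on the right gives X = 0, and sigma has independent rows. *)
have injf : injective (fun B => (H :* g B)%g).
  move=> B C /= eqBC; have : (g B * (g C)^-1)%g \in H.
    by rewrite -mem_rcoset -eqBC rcoset_refl.
  move/S0H; rewrite mxM; have [-> _] := gP B; have [_ ->] := gP C.
  rewrite mulmxA mulmxDr mulmx1 mulmxA rhoE mul1mx mulmxBr mulmx1.
  rewrite [_ *m (rho *m _)]mulmxA mulmxDl rhoE -mulmxA sr mulmx0 addr0 mul1mx.
  rewrite -addrA -mulmxBl => sub; have : ((B - C) *m sigma <= S0)%MS.
    by rewrite -(addKr S0 (_ *m _)) addmx_sub // eqmx_opp.
  case/submxP=> X XE.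
  have X0 : X = 0 by rewrite -[X]mulmx1 -rhoE mulmxA -XE -mulmxA sr mulmx0.
  move: XE; rewrite X0 mul0mx -(mul0mx _ sigma) => /(row_free_inj (row_base_free _)) /eqP.
  by rewrite subr_eq0 => /eqP.
have <- : #|[set: L] : H| = (p ^ k)%N.
  rewrite (index_p_complement pH); have [v v0 _] := p_complement_center pH.
  rewrite -(card_line_stabM v0) partnM ?cardG_gt0 ?expn_gt0 ?prime_gt0 //.
  rewrite part_p'nat ?mul1n ?part_pnat_id ?pnatX ?pnat_id // p'natE //.
  by rewrite -prime_coprime // coprime_sym coprime_card_line_stab.
rewrite -rk_sigma -card_mx -(card_imset _ injf) subset_leq_card //.
by apply/subsetP=> _ /imsetP[B _ ->]; apply/rcosetsP; exists (g B); rewrite ?inE.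
Qed.

Lemma p_complement_GL :
  (exists2 v : 'rV[F]_d, v != 0 & H :=: line_stab v) \/
  (exists2 w : 'cV[F]_d, w != 0 & H :=: coline_stab w).
Proof.
have [v v0 sv] := p_complement_center pH.
have [w w0 sw] := p_complement_axis.
pose S := (\sum_(u : 'rV[F]_d | (u != 0) && (transvections u \subset H)) <<u>>)%MS.
have vS : (v <= S)%MS by rewrite (sumsmx_sup v) ?v0 // genmxE.
have Sw : (S <= kermx w)%MS.
  apply/sumsmx_subP=> u /andP[u0 su]; rewrite genmxE; apply/sub_kermxP.
  exact: center_sub_axis sw.
have SH h : h \in H -> (S *m mx h <= S)%MS.
  move=> Hh; rewrite sumsmxMr; apply/sumsmx_subP=> u /andP[u0 su].
  rewrite (eqmxMr _ (genmxE _)) (sumsmx_sup (u *m mx h)) ?genmxE //.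
  by rewrite mulmx_GL_eq0 u0 -transvectionsJ -(conjGid Hh) conjSg.
have rk_v : \rank v = 1%N by rewrite rank_rV v0.
have rk_w : \rank w^T = 1%N by rewrite rank_rV -(inj_eq trmx_inj) trmxK trmx0 w0.
have S_gt0 : (0 < \rank S)%N by rewrite -rk_v mxrankS.
have S_le : (\rank S <= n)%N.
  by have := mxrankS Sw; rewrite mxrank_ker -[\rank w]mxrank_tr rk_w subn1.
have := leq_card_invariant_subspace SH; rewrite -qd => leqS.
have ltq : (geom_sum q d < q ^ d)%N.
  have qd0 : (0 < q ^ d)%N by rewrite expn_gt0 q0.
  apply: (@leq_ltn_trans (q ^ d - 1)); last by rewrite ltn_subrL qd0.
  by rewrite -geom_sumE leq_pmull // subn_gt0.
have {leqS ltq} : (\rank S * (d - \rank S) < d)%N.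
  by rewrite -(ltn_exp2l _ _ q1) (leq_ltn_trans leqS).
have [S1 _|Sn1] := eqVneq (\rank S) 1%N.
  left; exists v => //; apply: p_complement_eq pH (p_complement_line_stab v0) _.
  apply/subsetP=> h Hh; rewrite inE (submx_trans (submxMr _ vS)) // (submx_trans (SH h Hh)) //.
  by have := mxrank_leqif_sup vS; rewrite rk_v S1 => -[_ <-].
(* For 2 <= s <= d - 2 the product s (d - s) is at least d, against the bound just obtained. *)
have [Sn _|Snn] := eqVneq (\rank S) n; last by nia.
right; exists w => //; apply: p_complement_eq pH (p_complement_coline_stab w0) _.
apply/subsetP=> h Hh; rewrite inE.
(* S fills the hyperplane of w, so w^T spans the annihilator of S, and the action of H on columns
   preserves it. *)
have wS : (w^T <= kermx S^T)%MS.
  by apply/sub_kermxP; rewrite -trmx_mul (sub_kermxP Sw) trmx0.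
have Sw' : (kermx S^T <= w^T)%MS.
  have := mxrank_leqif_sup wS; rewrite rk_w mxrank_ker mxrank_tr Sn subSnn.
  by case=> _ <-.
apply: submx_trans Sw'; apply/sub_kermxP; rewrite -trmx_mul.
have [X XE] := submxP (SH h Hh).
by rewrite mulmxA XE -mulmxA (sub_kermxP Sw) mulmx0 trmx0.
Qed.

End Classification.
End Counting.

Lemma mem_Aut_orbitJ (gT : finGroupType) (G H : {group gT}) g :
  g \in G -> H \subset G -> H :^ g \in Aut_orbit G H.
Proof.
move=> Gg sHG.
apply: (@mem_Aut_orbit _ G H (H :^ g)%G _ (injm_conj G g)) => //.
  by rewrite morphim_conj setIid conjGid.
by rewrite morphim_conj (setIidPr sHG).
Qed.

(** R acts on the class by conjugation; the number of fixed points is congruent to the class size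
    modulo r, hence is not 0. *)
Lemma class_centralised_pgroup (gT : finGroupType) (r : nat) (K R : {group gT}) x :
  r.-group R -> R \subset K -> x \in K -> ~~ (r %| #|x ^: K|) ->
  exists2 y, y \in x ^: K & R \subset 'C[y].
Proof.
move=> rR sRK Kx ndv.
have actsR : [acts R, on x ^: K | 'J].
  by rewrite astabsJ (subset_trans sRK) ?class_norm.
have [fix0|[y]] := set_0Vmem 'Fix_(x ^: K | 'J)(R).
  by case/negP: ndv; rewrite /dvdn (pgroup_fix_mod rR actsR) fix0 cards0 mod0n.
by rewrite inE afixJ -sub_cent1 => /andP[xy cRy]; exists y.
Qed.

(** * Line and hyperplane stabilisers under conjugation and automorphisms *)

Section Automorphisms.

Local Open Scope ring_scope.

Variables (F : finFieldType) (n : nat).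
Local Notation d := n.+1.
Local Notation L := (gl_type F n).
Local Notation q := #|F|.

Lemma separating_col (v u : 'rV[F]_d) : ~~ (u <= v)%MS ->
  exists2 y : 'cV_d, v *m y = 0 & u *m y != 0.
Proof.
rewrite submxE => nz.
have [j uj] : exists j, col j (u *m cokermx v) != 0.
  apply/existsP; apply: contraNT nz; rewrite negb_exists => /forallP z.
  apply/eqP/matrixP=> a b; have /negPn/eqP/matrixP/(_ a 0) := z b.
  by rewrite [LHS]mxE => ->; rewrite !mxE.
exists (col j (cokermx v)); first by rewrite colE mulmxA mulmx_coker mul0mx.
by rewrite colE mulmxA -colE.
Qed.

Hypothesis n2 : (1 < n)%N.

(** Since d >= 3, some form psi vanishes on v without being proportional to w. Choose u with u psi =
    0 and u w = c nonzero: the transvection 1 + psi u fixes v but sends w to w + c psi. *)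
Lemma line_stab_neq_coline_stab (v : 'rV[F]_d) (w : 'cV[F]_d) : v != 0 -> w != 0 ->
  line_stab v != coline_stab w.
Proof.
move=> v0 w0; have wT0 : w^T != 0 by rewrite -(inj_eq trmx_inj) trmxK trmx0.
have [i] : exists i, ~~ (row i (kermx v^T) <= w^T)%MS.
  apply/row_subPn; apply/negP=> /mxrankS.
  by rewrite mxrank_ker mxrank_tr !rank_rV v0 wT0 subn1 leqNgt n2.
set psi := row i _ => psi_w.
have psi_v : v *m psi^T = 0.
  by rewrite -[v]trmxK -trmx_mul; have /sub_kermxP -> : (psi <= kermx v^T)%MS := row_sub _ _;
     rewrite trmx0.
have w_psi : ~~ (w^T <= psi)%MS.
  apply: contra psi_w => w_psi; have := mxrank_leqif_sup w_psi; rewrite !rank_rV wT0.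
  by case=> le <-; case: eqP le => // ->.
have [y psi_y w_y] := separating_col w_psi.
set u := y^T; have u_psi : u *m psi^T = 0 by rewrite -trmx_mul psi_y trmx0.
have [g gE _] := transvection_exists u_psi.
apply/eqP=> /setP/(_ g); rewrite [LHS]inE [RHS]inE gE mulmxDr mulmx1 mulmxA psi_v mul0mx addr0.
rewrite submx_refl mulmxDl mul1mx -mulmxA [u *m w]mx11_scalar.
have : (u *m w) 0 0 != 0.
  apply: contraNneq w_y => uw0; have : u *m w = 0 by rewrite [LHS]mx11_scalar uw0 raddf0.
  by move/(congr1 trmx); rewrite trmx_mul trmxK trmx0 => ->.
move: (_ 0 0) => c c0; rewrite mul_mx_scalar linearD linearZ /= trmxK => /esym E.
case/negP: psi_w; rewrite -(eqmx_scale _ c0).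
by rewrite -(addKr w^T (c *: psi)) addmx_sub // eqmx_opp.
Qed.

Variables (p k r : nat).
Hypotheses (pp : prime p) (qd : geom_sum q d = (p ^ k)%N) (charF : r \in [pchar F]).

Lemma p_complement_GL_Aut (H K : {group L}) :
  p_complement p [set: L] H -> p_complement p [set: L] K ->
  (K : {set L}) \in Aut_orbit [set: L] H.
Proof.
pose v0 : 'rV[F]_d := delta_mx 0 0.
have v00 : v0 != 0.
  by apply/eqP=> /rowP/(_ 0); rewrite !mxE !eqxx => /eqP; rewrite oner_eq0.
have line v : v != 0 -> line_stab v \in Aut_orbit [set: L] (line_stab_group v0).
  move=> v'0; have [g <-] := GL_transitive v00 v'0; rewrite -line_stabJ.
  by rewrite mem_Aut_orbitJ ?inE ?subsetT.
have all_orbit (M : {group L}) : p_complement p [set: L] M ->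
    (M : {set L}) \in Aut_orbit [set: L] (line_stab_group v0).
  case/(p_complement_GL pp n2 qd charF) => [[v v'0 ->]|[w w0 ->]]; first exact: line.
  have wT0 : w^T != 0 by rewrite -(inj_eq trmx_inj) trmxK trmx0.
  apply: orbit_trans (line _ wT0).
  apply: (@mem_Aut_orbit _ [set: L] (line_stab_group w^T) (coline_stab_group w) _
             (injm_contragr F n) (im_contragr F n) (subsetT _)).
  by rewrite /= contragr_line_stab trmxK.
move=> /all_orbit HO /all_orbit KO; apply: orbit_trans KO _.
by rewrite orbit_sym.
Qed.

Lemma line_stab_nconj (v : 'rV[F]_d) (w : 'cV[F]_d) : v != 0 -> w != 0 ->
  line_stab v \notin (coline_stab w :^: [set: L])%g.
Proof.
move=> v0 w0; apply/imsetP=> -[g _ E].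
have vg0 : v *m mx g^-1%g != 0 by rewrite mulmx_GL_eq0.
by case/eqP: (line_stab_neq_coline_stab vg0 w0); rewrite -line_stabJ E conjsgK.
Qed.

End Automorphisms.

(** * The affine group *)

(* The pair (v, g) is the affine map x |-> x g + v; products compose from left to right. *)
Definition affine (F : finFieldType) (n : nat) : Type := ('rV[F]_n.+1 * gl_type F n)%type.

Section Affine.

Local Open Scope ring_scope.

Variables (F : finFieldType) (n : nat).
Local Notation d := n.+1.
Local Notation L := (gl_type F n).
Local Notation V := 'rV[F]_d.
Local Notation A := (affine F n).
Local Notation q := #|F|.

HB.instance Definition _ := Finite.on A.

Definition aff_mul (x y : A) : A := (x.1 *m mx y.2 + y.1, (x.2 * y.2)%g).
Definition aff_one : A := (0, 1%g).
Definition aff_inv (x : A) : A := (- (x.1 *m mx x.2^-1%g), x.2^-1%g).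

Lemma aff_mulA : associative aff_mul.
Proof.
move=> x y z; congr (_, _); last exact: mulgA.
by rewrite /= mulmxDl mxM !mulmxA addrA.
Qed.

Lemma aff_mul1 : left_id aff_one aff_mul.
Proof. by case=> v g; rewrite /aff_mul /= mul0mx add0r mul1g. Qed.

Lemma aff_mulV : left_inverse aff_one aff_inv aff_mul.
Proof. by case=> v g; rewrite /aff_mul /= mulNmx mxVK addNr mulVg. Qed.

HB.instance Definition _ := Finite_isGroup.Build A aff_mulA aff_mul1 aff_mulV.

Lemma aff_mul1E (x y : A) : (x * y)%g.1 = x.1 *m mx y.2 + y.1. Proof. by []. Qed.
Lemma aff_mul2E (x y : A) : (x * y)%g.2 = (x.2 * y.2)%g. Proof. by []. Qed.

Lemma aff_translationJ (v : V) (y : A) : (((v, 1) : A) ^ y)%g = (v *m mx y.2, 1%g).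
Proof.
rewrite conjgE; congr (_, _); last by rewrite /= mul1g mulVg.
by rewrite /= mul1g mulNmx mxVK addrCA addNr addr0.
Qed.

Definition aff_sub (P : {set L}) : {set A} := [set x : A | x.2 \in P].

Lemma mem_aff_sub (P : {set L}) (x : A) : (x \in aff_sub P) = (x.2 \in P).
Proof. by rewrite inE. Qed.

Lemma group_set_aff_sub (P : {group L}) : group_set (aff_sub P).
Proof.
apply/group_setP; split=> [|x y]; first by rewrite mem_aff_sub group1.
by rewrite !mem_aff_sub aff_mul2E; apply: groupM.
Qed.
Canonical aff_sub_group (P : {group L}) := Group (group_set_aff_sub P).

Lemma card_aff_sub (P : {set L}) : #|aff_sub P| = (q ^ d * #|P|)%N.
Proof.
rewrite (_ : aff_sub P = setX [set: V] P); last by apply/setP=> -[v g]; rewrite !inE.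
by rewrite cardsX cardsT card_mx mul1n.
Qed.

Lemma aff_subT : aff_sub [set: L] = [set: A].
Proof. by apply/setP=> x; rewrite !inE. Qed.

Variables (p k r : nat).
Hypotheses (pp : prime p) (n2 : (1 < n)%N) (qd : geom_sum q d = (p ^ k)%N).
Hypotheses (charF : r \in [pchar F]).

Let q1 : (1 < q)%N. Proof. exact: finNzRing_gt1. Qed.
Let q0 : (0 < q)%N := ltnW q1.
Let pr : prime r := pcharf_prime charF.

Let rq : r.-nat q.
Proof. by have := abelem_pgroup (fin_ring_pchar_abelem charF); rewrite /pgroup cardsT. Qed.

Lemma dvdn_char_card : (r %| q)%N.
Proof.
by case/p_natP: rq => e qE; move: q1; rewrite qE; case: e {qE} => // e _; rewrite dvdn_exp.
Qed.

(** The full preimage of P keeps the index of P, and the translations contribute only q^d, prime to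
    p, to the order. *)
Lemma p_complement_aff_sub (P : {group L}) :
  p_complement p [set: L] P -> p_complement p [set: A] (aff_sub_group P).
Proof.
case/and5P=> _ pL _ iP cP; rewrite /p_complement pp subsetT /=.
have cpq := repunit_coprime pp (ltnW n2 : (1 < d)%N) q0 qd.
have cqp : coprime q p by rewrite coprime_sym.
have cT : #|[set: A]%G| = (q ^ d * #|[set: L]|)%N by rewrite -card_aff_sub aff_subT.
rewrite cT card_aff_sub dvdn_mull //= coprimeMl cP andbT (coprimeXl _ cqp) andbT.
rewrite -divgS ?subsetT // cT card_aff_sub divnMl ?expn_gt0 ?q0 //.
by rewrite divgS ?subsetT.
Qed.

Lemma pgroup_aff_sub (R : {group L}) : r.-group R -> r.-group (aff_sub R).
Proof. by rewrite /pgroup card_aff_sub pnatM pnatX rq => ->. Qed.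

(** Some conjugate y of x is centralised by all translations and by R. The translations force y to
    be a translation, and R then fixes its vector v. *)
Lemma aff_class_centralised (P R : {group L}) (x : A) :
  r.-group R -> R \subset P -> x \in aff_sub P -> ~~ (r %| #|x ^: aff_sub P|)%N ->
  exists v h, [/\ h \in P, x = (v *m mx h, 1%g) & forall g, g \in R -> v *m mx g = v].
Proof.
move=> rR sRP Px /(class_centralised_pgroup (pgroup_aff_sub rR)) [] //.
  by apply/subsetP=> y; rewrite !mem_aff_sub; apply: subsetP.
move=> y /imsetP[z Pz yE] cRy.
have cy (u : V) g : g \in R -> commute y (u, g).
  by move=> Rg; apply: commute_sym; apply/cent1P; apply: (subsetP cRy); rewrite mem_aff_sub.
have y2 : y.2 = 1%g.
  apply: mx_inj; rewrite mx1; apply/row_matrixP=> i; rewrite [RHS]rowE mulmx1 rowE.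
  have /(congr1 fst) := cy (delta_mx 0 i) 1%g (group1 _).
  by rewrite !aff_mul1E /= mx1 mulmx1 addrC => /addIr.
exists y.1, z.2^-1%g; split=> [||g Rg]; first by rewrite groupV -mem_aff_sub.
  rewrite -[x](conjgK z) -yE [y]surjective_pairing y2; exact: aff_translationJ.
have /(congr1 fst) := cy 0 g Rg.
by rewrite !aff_mul1E /= mul0mx add0r addr0.
Qed.

Lemma r'_class_card_aff_sub_gt0 (P : {group L}) :
  (0 < r'_class_card r (aff_sub_group P))%N.
Proof.
apply/card_gt0P; exists 1%g; rewrite inE group1 class1G cards1 dvdn1.
by rewrite neq_ltn prime_gt1 ?orbT.
Qed.

(** Only multiples of v are fixed by all transvections of centre v, so every element counted is a
    translation by one of the q multiples of v. *)
Lemma r'_class_card_line_stab_le (v : V) : v != 0 ->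
  (r'_class_card r (aff_sub_group (line_stab_group v)) <= q)%N.
Proof.
move=> v0; pose f (c : F) : A := (c *: v, 1%g).
apply: (@leq_trans #|f @: [set: F]|); last by rewrite (leq_trans (leq_imset_card _ _)) ?cardsT.
rewrite subset_leq_card //; apply/subsetP=> x; rewrite inE => /andP[Px ndv].
have rT := pgroup_transvections charF v.
have [u [h [Ph xE fixu]]] := aff_class_centralised rT (transvections_line_stab v) Px ndv.
have uv : (u <= v)%MS.
  apply: contraTT isT => nuv.
  have [y v_y u_y] := separating_col nuv.
  have [g gE _] := transvection_exists v_y.
  have /fixu : g \in transvections v by apply/transvectionsP; exists y.
  rewrite gE mulmxDr mulmx1 mulmxA -[X in _ = X]addr0 => /addrI /eqP.
  rewrite [u *m _]mx11_scalar mul_scalar_mx scaler_eq0 (negPf v0) orbF => /eqP u00.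
  by case/eqP: u_y; rewrite [LHS]mx11_scalar u00 raddf0.
have /sub_rVP[c uhE] : (u *m mx h <= v)%MS.
  by apply: submx_trans (submxMr _ uv) _; rewrite inE in Ph.
by apply/imsetP; exists c; rewrite ?inE // xE uhE.
Qed.

Lemma card_hyperplane (w : 'cV[F]_d) : w != 0 -> #|[set u : V | u *m w == 0]| = (q ^ n)%N.
Proof.
move=> w0; have rk : \rank (kermx w) = n.
  by rewrite mxrank_ker -mxrank_tr rank_rV -(inj_eq trmx_inj) trmxK trmx0 w0 subn1.
pose B := row_base (kermx w).
transitivity #|[set y *m B | y : 'rV[F]_(\rank (kermx w))]|.
  apply: eq_card => u; rewrite inE; apply/eqP/imsetP => [uw|[y _ ->]].
    have : (u <= B)%MS by rewrite eq_row_base; apply/sub_kermxP.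
    by case/submxP=> y ->; exists y.
  by apply/sub_kermxP; rewrite (submx_trans (submxMl _ _)) // eq_row_base.
rewrite card_imset; first by rewrite card_mx mul1n rk.
exact: row_free_inj (row_base_free _).
Qed.

(** For independent a and b, take a form y equal to 1 on both: the transvection 1 + y (b - a) sends
    a to b and fixes w. Proportional rows are joined through a third row of the hyperplane, whose
    dimension n is at least 2. *)
Lemma coline_stab_transitive (w : 'cV[F]_d) (u v : V) : w != 0 ->
  u != 0 -> v != 0 -> u *m w = 0 -> v *m w = 0 ->
  exists2 g : L, mx g *m w = w & u *m mx g = v.
Proof.
move=> w0; have step (a b : V) : a != 0 -> ~~ (b <= a)%MS -> a *m w = 0 -> b *m w = 0 ->
    exists2 g : L, mx g *m w = w & a *m mx g = b.
  move=> a0 nba aw bw.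
  have [y [ay by1]] : exists y : 'cV_d, a *m y = 1%:M /\ b *m y = 1%:M.
    have free : row_free (col_mx a b).
      rewrite /row_free eqn_leq rank_leq_row /= -addsmxE; have := mxrank_leqif_sup (addsmxSl a b).
      rewrite addsmx_sub submx_refl (negPf nba) /= => -[].
      by rewrite rank_rV a0 => le ne; rewrite ltn_neqAle ne le.
    have [B BE] := row_freeP free; exists (B *m const_mx 1).
    have := congr1 (mulmx^~ (const_mx 1 : 'cV[F]_(1 + 1))) BE.
    rewrite mul1mx -mulmxA mul_col_mx => E.
    have := congr1 usubmx E; have := congr1 dsubmx E; rewrite col_mxKu col_mxKd => -> ->.
    by split; apply/matrixP=> i j; rewrite !mxE !ord1 eqxx.
  have bay : (b - a) *m y = 0 by rewrite mulmxBl ay by1 subrr.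
  have [g gE _] := transvection_exists bay; exists g; rewrite gE.
    by rewrite mulmxDl mul1mx -mulmxA mulmxBl aw bw subrr mulmx0 addr0.
  by rewrite mulmxDr mulmx1 mulmxA ay mul1mx addrC subrK.
move=> u0 v0 uw vw; have [vu|] := boolP (v <= u)%MS; last by move=> nvu; apply: step.
have [i] : exists i, ~~ (row i (kermx w) <= u)%MS.
  apply/row_subPn; apply/negP=> /mxrankS.
  rewrite mxrank_ker rank_rV u0 -mxrank_tr rank_rV -(inj_eq trmx_inj) trmxK trmx0 w0.
  by rewrite subn1 leqNgt n2.
set z := row i _ => nzu.
have zw : z *m w = 0 by apply/sub_kermxP; apply: row_sub.
have z0 : z != 0 by apply: contraNneq nzu => ->; apply: sub0mx.
have [g gw ug] := step u z u0 nzu uw zw.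
have [|h hw zh] := step z v z0 _ zw vw.
  apply: contra nzu => vz; apply: submx_trans vu.
  have := mxrank_leqif_sup vz; rewrite !rank_rV v0 z0 => -[_ <-] //.
by exists (g * h)%g; [rewrite mxM -mulmxA hw | rewrite mxM mulmxA ug].
Qed.

(** The nonzero translations along the hyperplane form one class of size q^n - 1, prime to r. With
    the identity they make q^n elements, more than q since n > 1. *)
Lemma r'_class_card_coline_stab_gt (w : 'cV[F]_d) : w != 0 ->
  (q < r'_class_card r (aff_sub_group (coline_stab_group w)))%N.
Proof.
move=> w0; have qn : (q < q ^ n)%N by rewrite -{1}(expn1 q) ltn_exp2l.
apply: leq_trans qn _; rewrite -(card_hyperplane w0).
pose f (u : V) : A := (u, 1%g).
have injf : injective f by move=> u v [].
rewrite -(card_imset _ injf) subset_leq_card //.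
apply/subsetP=> _ /imsetP[u + ->]; rewrite inE => /eqP uw; rewrite inE.
rewrite mem_aff_sub group1 /=.
have [u0|u0] := eqVneq u 0.
  rewrite u0 (_ : f 0 = 1%g) // class1G cards1 dvdn1.
  by rewrite neq_ltn prime_gt1 ?orbT.
have -> : (f u ^: aff_sub (coline_stab w))%g = f @: ([set v : V | v *m w == 0] :\ 0).
  apply/setP=> y; apply/imsetP/imsetP => [[x Px ->]|[v]].
    exists (u *m mx x.2); last exact: aff_translationJ.
    rewrite !inE mulmx_GL_eq0 u0 /= -mulmxA.
    move: Px; rewrite mem_aff_sub inE => /submxP[c /(congr1 trmx)].
    by rewrite trmxK trmx_mul trmxK => ->; rewrite mulmxA uw mul0mx.
  rewrite !inE => /andP[v0 /eqP vw] ->.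
  have [g gw ug] := coline_stab_transitive w0 u0 v0 uw vw.
  exists (0, g); first by rewrite mem_aff_sub inE gw submx_refl.
  by rewrite aff_translationJ ug.
rewrite card_imset //; have := cardsD1 (0 : V) [set v : V | v *m w == 0].
rewrite card_hyperplane // inE mul0mx eqxx add1n => qnE.
apply/negP=> rd; have : (r %| q ^ n)%N by rewrite dvdn_exp ?dvdn_char_card // ltnW.
rewrite qnE -add1n dvdn_addl // dvdn1 => /eqP r1.
by move: pr; rewrite r1.
Qed.

End Affine.

(* The three families of groups *)
Local Close Scope group_scope.

Theorem mainTheorem5 (p : nat) (p_prime : prime p)
    (p_proj : exists q d k : nat,
       [/\ prime_power q, 3 <= d, 1 <= k & p ^ k = (q ^ d - 1) %/ (q - 1)])
    (N : nat) (N_gt0 : 0 < N) :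
  [/\ exists (gT : finGroupType) (G : {group gT}),
        (forall H K : {group gT}, p_complement p G H -> p_complement p G K ->
           (K : {set gT}) \in Aut_orbit G H)
        /\ N <= #|p_complement_classes p G|,
      exists (gT : finGroupType) (G : {group gT}),
        (forall H K : {group gT}, p_complement p G H -> p_complement p G K ->
           (H \isog K)%g)
        /\ N <= #|p_complement_Aut_orbits p G|
    & exists (gT : finGroupType) (G : {group gT}),
        N <= #|p_complement_isog_classes p G| ].
Proof.
case: p_proj => q [[|n] [k [[r [e [pr e0 qE]] // n2 _ pkE]]]].
have [F charF qF] := PrimePowerField pr e0.
rewrite -qE in qF.
have q1 : 1 < q by rewrite -qF finNzRing_gt1.
have qd : geom_sum #|F| n.+1 = p ^ k.
  by rewrite qF pkE -geom_sumE mulKn // subn_gt0.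
pose v : 'rV[F]_n.+1 := delta_mx 0%R 0%R.
have v0 : v != 0%R.
  by apply/eqP=> /rowP/(_ 0%R); rewrite !mxE !eqxx => /eqP; rewrite oner_eq0.
have w0 : v^T%R != 0%R by rewrite -(inj_eq trmx_inj) trmxK trmx0.
have pA := p_complement_line_stab p_prime n2 qd v0.
have pB := p_complement_coline_stab p_prime n2 qd w0.
have nAB := line_stab_nconj n2 v0 w0.
have AB := p_complement_GL_Aut n2 p_prime qd charF pA pB.
have [_ pL _ _ _] := and5P pA.
(* A group of order p^N has at least N elements, as (i) and (iii) require, and subgroups of each
   order p^j with j < N, as (ii) requires. The type ['Z_m] has m elements only for m > 1, hence the
   use of N > 0 next. *)
pose C : finGroupType := 'Z_(p ^ N).
have pN1 : 1 < p ^ N by rewrite -(exp1n N) ltn_exp2r ?prime_gt1.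
have cC : #|[set: C]| = p ^ N by rewrite cardsT card_ord Zp_cast.
have pC : (p.-group [set: C])%g by rewrite /pgroup cC pnatX pnat_id.
have NC : N <= #|C| by rewrite -cardsT cC ltnW // ltn_expl ?prime_gt1.
have conj_base := wr_base_p_complement_conj p_prime pL (p_complement_GL_Aut n2 p_prime qd charF).
split.
- exists (wreath (gl_type F n) C), (wr_base (gl_type F n) C); split; first exact: conj_base.
  by apply: leq_trans NC (card_p_complement_classes_wr_base _ p_prime pL pA pB nAB).
- exists (wreath (gl_type F n) C), [set: wreath (gl_type F n) C]%G; split.
    move=> H K; rewrite !p_complement_wreath // => pH pK.
    by have [_ _ sH _ _] := and5P pH; apply: isog_Aut_orbit sH (conj_base C H K pH pK).
  refine (leq_card_Aut_orbits_wreath p_prime pL pC pA pB nAB AB cC).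
exists (wreath (affine F n) C), (wr_base (affine F n) C).
have pA' := p_complement_aff_sub p_prime n2 qd pA.
have pB' := p_complement_aff_sub p_prime n2 qd pB.
have [_ pAff _ _ _] := and5P pA'.
apply: (leq_card_isog_classes_wr_base p_prime pAff pA' pB' pr _ NC).
rewrite r'_class_card_aff_sub_gt0 //=.
by apply: leq_ltn_trans (r'_class_card_line_stab_le _ v0) (r'_class_card_coline_stab_gt _ _ w0).
Qed.
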